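(* Let $X_1,X_2,\ldots,X_n$ be i.i.d. $\Omega$-valued random variables with distribution $F$, let $N(\cdot)$ be a proximity map on $\Omega$, let $D_n$ be the associated vertex-random proximity catch digraph (PCD), and let $G_{\text{or}}(D_n)$ be its underlying graph. The relative edge density $\rho_{\text{or}}(D_n)$ of $G_{\text{or}}(D_n)$ is a one-sample $U$-statistic of degree 2 and is an unbiased estimator of $p_{\text{or}}(N)$. If, additionally, $\nu_{\text{or}}(N):=\mathbf{Cov}[h^{\text{or}}_{ij},h^{\text{or}}_{ik}]>0$ for all distinct $i,j,k\in\{1,2,\ldots,n\}$, then $$\sqrt n\,\bigl[\rho_{\text{or}}(D_n)-p_{\text{or}}(N)\bigr]\stackrel{\mathcal L}{\longrightarrow}\mathcal N(0,4\,\nu_{\text{or}}(N))\quad\text{as } n\to\infty .$$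
   Context: $(\Omega,\mathcal M)$ is a measurable space. A proximity map is a map $N:\Omega\to\mathcal P(\Omega)$ (with $\mathcal P$ the power set) associating with each $x\in\Omega$ a proximity region $N(x)\subseteq\Omega$ (in the paper, $N(x)$ is defined in terms of the distance between $x$ and a given set $\mathcal Y_m\subset\Omega$); events involving $N$ are assumed measurable. Its $\Gamma_1$-region is $\Gamma_1(x,N)=\{z\in\Omega: x\in N(z)\}$. The PCD $D_n$ has vertex set $\mathcal V=\{X_1,\ldots,X_n\}$ and arc set $\mathcal A$ given by $(X_i,X_j)\in\mathcal A\iff X_j\in N(X_i)$ for $i\neq j$. The underlying graph $G_{\text{or}}(D_n)=(\mathcal V,\mathcal E_{\text{or}})$ has $X_iX_j\in\mathcal E_{\text{or}}$ iff $(X_i,X_j)\in\mathcal A$ or $(X_j,X_i)\in\mathcal A$, equivalently $X_j\in N(X_i)\cup\Gamma_1(X_i,N)$. Its relative edge density is $\rho_{\text{or}}(D_n)=2|\mathcal E_{\text{or}}|/(n(n-1))$. Put $h^{\text{or}}_{ij}=\mathbf I(X_j\in N(X_i)\cup\Gamma_1(X_i,N))$ and $p_{\text{or}}(N)=P(X_j\in N(X_i)\cup\Gamma_1(X_i,N))$ for $i\neq j$. $\stackrel{\mathcal L}{\longrightarrow}$ is convergence in law and $\mathcal N(\mu,\sigma^2)$ the normal distribution with mean $\mu$ and variance $\sigma^2$. *)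

(* Defs.v *)
From HB Require Import structures.
From mathcomp Require Import all_boot all_order all_algebra finmap.
From mathcomp Require Import all_classical all_reals all_analysis.

Set Implicit Arguments.
Unset Strict Implicit.
Unset Printing Implicit Defensive.

Import Order.TTheory GRing.Theory Num.Theory.
Import numFieldTopology.Exports.

Local Open Scope classical_set_scope.
Local Open Scope ring_scope.

Definition mutually_independent d d' (T : measurableType d)
    (Omega : measurableType d') (R : realType) (P : probability T R)
    (I : choiceType) (X : I -> {RV P >-> Omega}) : Prop :=
  forall (J : {fset I}) (B : I -> set Omega), (forall i, measurable (B i)) ->
    P (\bigcap_(i in [set` J]) (X i @^-1` B i)) =
    (\prod_(i <- J) P (X i @^-1` B i))%E.

Definition iid d d' (T : measurableType d) (Omega : measurableType d')
    (R : realType) (P : probability T R) (F : probability Omega R)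
    (I : choiceType) (X : I -> {RV P >-> Omega}) : Prop :=
  mutually_independent X /\
  forall i (A : set Omega), measurable A -> distribution P (X i) A = F A.

(* Convergence of the distribution functions at every continuity point of the
   limiting distribution function. *)
Definition cvg_in_law d (T : measurableType d) (R : realType)
    (P : probability T R) (Y : nat -> T -> R) (mu : probability (measurableTypeR R) R) : Prop :=
  (forall n, measurable_fun [set: T] (Y n)) /\
  forall x : R, {for x, continuous (fun t : R => mu `]-oo, t]%classic)} ->
    P (Y n @^-1` `]-oo, x]%classic) @[n --> \oo] --> mu `]-oo, x]%classic.

(* The second parameter of normal_prob is the standard deviation. *)
Definition normal_law (R : realType) (m v : R) : probability (measurableTypeR R) R :=
  normal_prob m (Num.sqrt v).

(* The kernel does not depend on the sample size. *)
Definition is_U_statistic_deg2 d d' (T : measurableType d)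
    (Omega : measurableType d') (R : realType) (P : probability T R)
    (F : probability Omega R) (X : nat -> {RV P >-> Omega})
    (U : nat -> T -> R) : Prop :=
  exists k : Omega -> Omega -> R,
    [/\ measurable_fun [set: Omega * Omega] (fun z => k z.1 z.2),
        forall x y, k x y = k y x,
        (F \x F)%E.-integrable [set: Omega * Omega]
          (fun z => (k z.1 z.2)%:E) &
        forall n, (2 <= n)%N -> forall w,
          U n w = ('C(n, 2)%:R)^-1 *
            \sum_(i < n) \sum_(j < n | (i < j)%N) k (X i w) (X j w)].

(* Joint measurability of [y \in N x]; it makes every event built from N and
   the sample measurable. *)
Definition measurable_proximity d (Omega : measurableType d)
    (N : Omega -> set Omega) : Prop :=
  measurable [set z : Omega * Omega | N z.1 z.2].

Definition Gamma1 (Omega : Type) (N : Omega -> set Omega) (x : Omega)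
  : set Omega := [set z | N z x].

(* The vertex X_i is represented by its index i : 'I_n. *)
Definition pcd_arcs (Omega : Type) (N : Omega -> set Omega) (n : nat)
    (x : 'I_n -> Omega) : {set 'I_n * 'I_n} :=
  [set a | (a.1 != a.2) && `[< N (x a.1) (x a.2) >]]%SET.

Definition underlying_edges (V : finType) (A : {set V * V}) : {set {set V}} :=
  [set e : {set V} | [exists i, exists j,
    [&& i != j, e == [set i; j]%SET & ((i, j) \in A) || ((j, i) \in A)]]]%SET.

Definition relative_edge_density (R : realType) (n : nat)
    (E : {set {set 'I_n}}) : R :=
  2 * #|E|%:R / (n%:R * (n%:R - 1)).

Section vertex_random_pcd.
Context d d' (T : measurableType d) (Omega : measurableType d') (R : realType).
Variables (P : probability T R) (X : nat -> {RV P >-> Omega}).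
Variable N : Omega -> set Omega.

Definition rho_or (n : nat) (w : T) : R :=
  relative_edge_density R
    (underlying_edges (pcd_arcs N (fun i : 'I_n => X i w))).

Definition h_or (i j : nat) (w : T) : R :=
  \1_(N (X i w) `|` Gamma1 N (X i w)) (X j w).

(* For an i.i.d. sample, p_or and nu_or do not depend on the choice of the
   distinct indices. *)
Definition p_or (i j : nat) : R :=
  fine (P [set w | (N (X i w) `|` Gamma1 N (X i w)) (X j w)]).

Definition nu_or (i j k : nat) : R :=
  fine (covariance P (h_or i j) (h_or i k)).

End vertex_random_pcd.

(* Main.v *)
Require Import Defs.
From HB Require Import structures.
From mathcomp Require Import all_boot all_order all_algebra finmap.
From mathcomp Require Import all_classical all_reals all_analysis.
From mathcomp Require Import measurable_realfun.
From mathcomp Require Import ring lra zify.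

Import Order.TTheory GRing.Theory Num.Theory.
Import numFieldTopology.Exports numFieldNormedType.Exports.

Local Open Scope classical_set_scope.
Local Open Scope ring_scope.

(** The edge density is the average over pairs [i < j] of [k (X_i, X_j)], where
    the kernel [k (x, y)] tells whether [y] lies in [N x] or [x] in [N y]. The
    kernel is symmetric, so this is a U-statistic of degree 2, and each term has
    the same mean [p], so it is unbiased.

    For the limit law, use the Hoeffding decomposition
    [k (x, y) = p + phi x + phi y + g (x, y)], where [phi x] is the mean of
    [k (x, X)] minus [p], and [g] has mean 0 in either argument. Then
    [sqrt n * (rho - p)] is the normalized sum [W] of the independent variables
    [2 * phi (X_i)] plus a multiple of the sum of all [g (X_i, X_j)]. The terms
    of the latter for different pairs are orthogonal, so that this remainder has
    a second moment of order [1 / n] ([mean_off_diagonal_sum_sqr]). Moreover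
    [4 * nu] is the variance of [2 * phi (X_i)], since [h_ij] and [h_il] are
    independent given [X_i] ([nu_orE]).

    The central limit theorem for [W] is proved by Stein's method. If [h] is a
    Lipschitz function with values in [[0, 1]] and [c] is its mean under the
    normal law of variance [s ^+ 2], then the equation
    [s ^+ 2 * f' w - w * f w = h w - c] has a solution for which [f], [f'] and
    [w * f w] are bounded ([stein_solution]), whence a Taylor estimate for [f]
    ([stein_solution_taylor]). So [E h (W) - c] is the mean of
    [s ^+ 2 * f' W - W * f W]; expanding [f] around [W] deprived of one summand,
    which is independent of that summand, shows that it is of order
    [1 / sqrt n] ([stein_sum_bound], [stein_clt_rate]). Distribution functions
    are then squeezed between means of piecewise linear functions
    ([cvg_cdf_of_lipschitz]).

    Independence enters only through [freezing]: in the mean of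
    [psi (X_a, Z)], where [Z] is a function of the other variables, [X_a] may be
    integrated out with [Z] fixed. All variables involved are bounded for each
    [n], so their means are real numbers. *)

(** * Means of bounded measurable functions *)
Section bounded_measurable_functions.
Set Implicit Arguments.
Unset Strict Implicit.
Context (R : realType).

Definition bmeasurable d (T : measurableType d) (f : T -> R) : Prop :=
  measurable_fun [set: T] f /\ exists M, forall x, `|f x| <= M.

Section closure.
Context d (T : measurableType d).
Implicit Types f g : T -> R.

Lemma bmeasurable_cst (c : R) : bmeasurable (fun _ : T => c).
Proof. by split; [by []|exists `|c|]. Qed.

Lemma bmeasurableD f g : bmeasurable f -> bmeasurable g ->
  bmeasurable (fun x => f x + g x).
Proof.
move=> [mf [M fM]] [mg [N gN]]; split; first exact: measurable_funD.
by exists (M + N) => x; rewrite (le_trans (ler_normD _ _))// lerD.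
Qed.

Lemma bmeasurableM f g : bmeasurable f -> bmeasurable g ->
  bmeasurable (fun x => f x * g x).
Proof.
move=> [mf [M fM]] [mg [N gN]]; split; first exact: measurable_funM.
by exists (M * N) => x; rewrite normrM ler_pM.
Qed.

Lemma bmeasurableZ (c : R) f : bmeasurable f -> bmeasurable (fun x => c * f x).
Proof. by move=> ?; apply: bmeasurableM => //; exact: bmeasurable_cst. Qed.

Lemma bmeasurableB f g : bmeasurable f -> bmeasurable g ->
  bmeasurable (fun x => f x - g x).
Proof.
move=> [mf [M fM]] [mg [N gN]]; split; first exact: measurable_funB.
by exists (M + N) => x; rewrite (le_trans (ler_normB _ _))// lerD.
Qed.

Lemma bmeasurableX f n : bmeasurable f -> bmeasurable (fun x => f x ^+ n).
Proof.
move=> bf; elim: n => [|n ih].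
  by under eq_fun do rewrite expr0; exact: bmeasurable_cst.
by under eq_fun do rewrite exprS; exact: bmeasurableM.
Qed.

Lemma bmeasurable_norm f : bmeasurable f -> bmeasurable (fun x => `|f x|).
Proof.
move=> [mf [M fM]]; split; first exact: measurableT_comp.
by exists M => x; rewrite normr_id.
Qed.

Lemma bmeasurable_sum I (s : seq I) (Q : pred I) (F : I -> T -> R) :
  (forall i, Q i -> bmeasurable (F i)) ->
  bmeasurable (fun x => \sum_(i <- s | Q i) F i x).
Proof.
move=> bF; elim: s => [|i s ih].
  by under eq_fun do rewrite big_nil; exact: bmeasurable_cst.
case Qi : (Q i); under eq_fun do rewrite big_cons Qi; last exact: ih.
by apply: bmeasurableD => //; exact: bF.
Qed.

Lemma bmeasurable_comp d' (U : measurableType d') (g : U -> R) (h : T -> U) :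
  bmeasurable g -> measurable_fun [set: T] h -> bmeasurable (fun x => g (h x)).
Proof.
move=> [mg [M gM]] mh; split; first exact: measurableT_comp.
by exists M.
Qed.

End closure.

Section expectation.
Context d (T : measurableType d) (P : probability T R).
Implicit Types f g : T -> R.

Lemma bmeasurable_integrable f : bmeasurable f ->
  P.-integrable [set: T] (EFin \o f).
Proof.
move=> [mf [M fM]]; apply: measurable_bounded_integrable => //.
  by rewrite -ge0_fin_numE// fin_num_measure.
exists M; split; first exact: num_real.
by move=> N MN x _ /=; exact: le_trans (fM x) (ltW MN).
Qed.

Lemma EFin_mean f : bmeasurable f ->
  (\int[P]_x f x)%:E = (\int[P]_x (f x)%:E)%E.
Proof.
move=> bf; rewrite /Rintegral fineK//.
exact: (integrable_fin_num _ (bmeasurable_integrable bf)).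
Qed.

Lemma mean_cst (c : R) : \int[P]_x c = c.
Proof. by rewrite Rintegral_cst// (congr1 fine (probability_setT P)) mulr1. Qed.

Lemma meanD f g : bmeasurable f -> bmeasurable g ->
  \int[P]_x (f x + g x) = \int[P]_x f x + \int[P]_x g x.
Proof. by move=> bf bg; apply: RintegralD => //; exact: bmeasurable_integrable. Qed.

Lemma meanB f g : bmeasurable f -> bmeasurable g ->
  \int[P]_x (f x - g x) = \int[P]_x f x - \int[P]_x g x.
Proof. by move=> bf bg; apply: RintegralB => //; exact: bmeasurable_integrable. Qed.

Lemma meanZ (c : R) f : bmeasurable f ->
  \int[P]_x (c * f x) = c * \int[P]_x f x.
Proof. by move=> bf; apply: RintegralZl => //; exact: bmeasurable_integrable. Qed.

Lemma mean_le f g : bmeasurable f -> bmeasurable g ->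
  (forall x, f x <= g x) -> \int[P]_x f x <= \int[P]_x g x.
Proof.
by move=> bf bg fg; apply: le_Rintegral => //; exact: bmeasurable_integrable.
Qed.

Lemma norm_mean_le f : bmeasurable f ->
  `|\int[P]_x f x| <= \int[P]_x `|f x|.
Proof. by move=> bf; apply: le_normr_Rintegral => //; exact: bmeasurable_integrable. Qed.

Lemma norm_mean_bound f (M : R) : bmeasurable f -> (forall x, `|f x| <= M) ->
  `|\int[P]_x f x| <= M.
Proof.
move=> bf fM; rewrite (le_trans (norm_mean_le bf))// -[leRHS]mean_cst.
by apply: mean_le => //; [exact: bmeasurable_norm|exact: bmeasurable_cst].
Qed.

Lemma mean_sum I (s : seq I) (Q : pred I) (F : I -> T -> R) :
  (forall i, Q i -> bmeasurable (F i)) ->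
  \int[P]_x (\sum_(i <- s | Q i) F i x) = \sum_(i <- s | Q i) \int[P]_x F i x.
Proof.
move=> bF; elim: s => [|i s ih].
  by under eq_Rintegral do rewrite big_nil; rewrite big_nil mean_cst.
rewrite big_cons; under eq_Rintegral do rewrite big_cons.
case Qi : (Q i) => //; rewrite meanD ?ih//; first exact: bF.
exact: bmeasurable_sum.
Qed.

End expectation.
End bounded_measurable_functions.

(** * Integrating out one variable of an i.i.d. sample *)
Section freezing.
Set Implicit Arguments.
Unset Strict Implicit.
Context (R : realType) d d' (T : measurableType d) (Omega : measurableType d').
Context (P : probability T R) (F : probability Omega R).
Variable X : nat -> {RV P >-> Omega}.

(** Finite-dimensional events that do not involve [X a]. They form a pi-system,
    and a variable measurable for the sigma-algebra they generate is, in the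
    usual words, a function of the [X i] with [i != a]. *)
Definition cylinders_avoiding (a : nat) : set (set T) :=
  [set A | exists (J : {fset nat}) (B : nat -> set Omega),
    [/\ a \notin J, forall i, measurable (B i) &
        A = \bigcap_(i in [set` J]) (X i @^-1` B i)]].

(** The same points as [T] with that coarser sigma-algebra, so that depending
    only on the [X i], [i != a], can be proved by the ordinary closure properties
    of measurable functions. *)
Definition avoiding a : Type := g_sigma_algebraType (cylinders_avoiding a).
HB.instance Definition _ a := Measurable.on (avoiding a).

Lemma measurable_X i (B : set Omega) : measurable B -> measurable (X i @^-1` B).
Proof.
by move=> mB; rewrite -[_ @^-1` _]setTI; exact: measurable_funP.
Qed.

Lemma cylinders_avoiding_measurable a : cylinders_avoiding a `<=` measurable.
Proof.
move=> _ [J [B [_ mB ->]]]; apply: fin_bigcap_measurable; first exact: finite_fset.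
by move=> i _; exact: measurable_X.
Qed.

Lemma cylinders_avoidingT a : cylinders_avoiding a [set: T].
Proof.
exists fset0, (fun=> setT); split => //.
by apply/seteqP; split => // x _ i /=; rewrite inE.
Qed.

Lemma cylinders_avoidingI a : setI_closed (cylinders_avoiding a).
Proof.
move=> _ _ [J [B [aJ mB ->]]] [K [C [aK mC ->]]].
exists (J `|` K)%fset, (fun i => (if i \in J then B i else setT) `&`
                                 (if i \in K then C i else setT)); split.
- by rewrite inE negb_or aJ.
- by move=> i; apply: measurableI; case: ifP.
- apply/seteqP; split => [x [xJ xK] i /= _|x xJK].
    split; first by case: ifPn => // iJ; exact: xJ.
    by case: ifPn => // iK; exact: xK.
  split => i /= iS.
    by have /= := xJK i; rewrite inE iS => /(_ isT)[].
  by have /= := xJK i; rewrite inE iS orbT => /(_ isT)[].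
Qed.

Lemma measurable_avoiding_X a i : i != a ->
  measurable_fun [set: avoiding a] (X i : avoiding a -> Omega).
Proof.
move=> ia _ B mB; rewrite setTI; apply: sub_sigma_algebra.
exists [fset i]%fset, (fun=> B); split => //; first by rewrite inE eq_sym.
apply/seteqP; split => [x Bx j /=|x xB]; first by rewrite inE => /eqP ->.
by apply: (xB i); rewrite /= inE.
Qed.

Lemma measurable_avoidingW a d2 (E : measurableType d2) (Z : T -> E) :
  measurable_fun [set: avoiding a] (Z : avoiding a -> E) ->
  measurable_fun [set: T] Z.
Proof.
move=> mZ _ C mC.
have sC : <<s cylinders_avoiding a >> ([set: T] `&` Z @^-1` C).
  exact: mZ measurableT C mC.
have := smallest_sub (@sigma_algebra_measurable _ T)
  (@cylinders_avoiding_measurable a).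
exact.
Qed.

Hypothesis X_iid : iid F X.

Lemma prob_X i (B : set Omega) : measurable B -> P (X i @^-1` B) = F B.
Proof. by move=> mB; have [_ h] := X_iid; rewrite -(h i). Qed.

Lemma cylinder_independent a (A : set T) (B : set Omega) :
  cylinders_avoiding a A -> measurable B ->
  (P (A `&` X a @^-1` B) = F B * P A)%E.
Proof.
move=> [J [C [aJ mC ->]]] mB.
have [indX _] := X_iid.
pose C' i := if i == a then B else C i.
have mC' i : measurable (C' i) by rewrite /C'; case: ifP.
rewrite [X in P X](_ : _ = \bigcap_(i in [set` (a |` J)%fset]) (X i @^-1` C' i)); last first.
  apply/seteqP; split => [x [xJ xB] i /=|x xJ].
    rewrite !inE /C'; case: eqVneq => [->//|_ /= iJ]; exact: xJ.
  split => [i /= iJ|].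
    have /= := xJ i; rewrite !inE iJ orbT /C' => /(_ isT).
    by case: eqVneq => // ia; rewrite ia (negbTE aJ) in iJ.
  by have /= := xJ a; rewrite !inE eqxx /C' eqxx => /(_ isT).
rewrite indX// big_fsetU1//= indX//; congr (_ * _)%E.
  by rewrite /C' eqxx prob_X.
by apply: eq_big_seq => i iJ; rewrite /C'; case: eqVneq => // ia; rewrite ia (negbTE aJ) in iJ.
Qed.

(** The finite measures [A |-> P (A and X a in B)] and [A |-> F B * P A] agree
    on the pi-system of cylinders, hence on the sigma-algebra it generates. *)
Lemma avoiding_independent a (A : set T) (B : set Omega) :
  <<s cylinders_avoiding a >> A -> measurable B ->
  (P (A `&` X a @^-1` B) = F B * P A)%E.
Proof.
move=> sA mB.
have mXB := measurable_X a mB.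
have FB0 : 0 <= fine (F B) by rewrite fine_ge0.
have FBE : (fine (F B))%:E = F B by rewrite fineK// fin_num_measure.
pose m1 := mrestr P mXB.
pose m2 := mscale (NngNum FB0) P.
rewrite -FBE; change (m1 A = m2 A).
apply: (g_sigma_algebra_measure_unique (cylinders_avoiding a)
  (@cylinders_avoiding_measurable a) (fun=> setT)) => //.
- by move=> _; exact: cylinders_avoidingT.
- by apply/seteqP; split => // x _; exists 0%N.
- exact: cylinders_avoidingI.
- move=> C sC; change (P (C `&` X a @^-1` B) = (fine (F B))%:E * P C)%E.
  by rewrite FBE; exact: cylinder_independent.
- move=> _; change (P ([set: T] `&` X a @^-1` B) < +oo)%E.
  by rewrite setTI -ge0_fin_numE//; exact: fin_num_measure.
Qed.

(** Tonelli's theorem gives measurability of partial integrals of non-negative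
    functions; the bound [M] is added to [psi] to reduce to that case. *)
Lemma bmeasurable_freeze d2 (E : measurableType d2) (psi : Omega * E -> R) :
  bmeasurable psi -> bmeasurable (fun z => \int[F]_x psi (x, z)).
Proof.
move=> bpsi; have [mpsi [M psiM]] := bpsi; split; last first.
  exists M => z; apply: norm_mean_bound => //.
  exact: bmeasurable_comp bpsi (pair2_measurable z).
pose f (zx : E * Omega) := (psi (zx.2, zx.1) + M)%:E.
have mf : measurable_fun [set: E * Omega] f.
  apply/measurable_EFinP/measurable_funD => //.
  apply: (measurableT_comp mpsi).
  by apply: measurable_fun_pair; [exact: measurable_snd|exact: measurable_fst].
have f0 zx : (0 <= f zx)%E.
  by rewrite lee_fin -lerBlDr sub0r; have := psiM (zx.2, zx.1); rewrite ler_norml => /andP[].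
have := measurable_fun_fubini_tonelli_F (m2 := F) f mf f0.
move=> mfF.
rewrite (_ : (fun z => _) = fun z => fine (fubini_F F f z) - M).
  by apply: measurable_funB => //; exact: measurableT_comp mfF.
apply/funext => z; rewrite /fubini_F /f.
have bz : bmeasurable (fun x => psi (x, z)).
  exact: bmeasurable_comp bpsi (pair2_measurable z).
have bc : bmeasurable (fun x : Omega => M) by exact: bmeasurable_cst.
by rewrite -/(Rintegral F setT (fun x => psi (x, z) + M)) meanD// mean_cst addrK.
Qed.

(** The single form in which independence is used below: the joint law of
    [X a] and [Z] is the product of their laws, by uniqueness of product
    measures, so Fubini's theorem integrates [X a] out with [Z] frozen. *)
Lemma freezing a d2 (E : measurableType d2) (Z : T -> E) (psi : Omega * E -> R) :
  measurable_fun [set: avoiding a] (Z : avoiding a -> E) -> bmeasurable psi ->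
  \int[P]_w psi (X a w, Z w) = \int[P]_w \int[F]_x psi (x, Z w).
Proof.
move=> sZ bpsi; have mZ := measurable_avoidingW sZ.
have bpsiZ := bmeasurable_freeze bpsi.
pose Zm : {mfun T >-> E} := HB.pack Z (isMeasurableFun.Build _ _ T E Z mZ).
pose Q := distribution P Zm.
have mXZ : measurable_fun [set: T] (fun w => (X a w, Z w)).
  by apply: measurable_fun_pair.
pose XZ : {mfun T >-> (Omega * E)%type} :=
  HB.pack (fun w => (X a w, Z w)) (isMeasurableFun.Build _ _ T (Omega * E)%type _ mXZ).
pose m' := distribution P XZ.
have m'E C : measurable C -> (F \x Q)%E C = m' C.
  apply: product_measure_unique => A B mA mB.
  change (P ((fun w => (X a w, Z w)) @^-1` (A `*` B)) = F A * P (Z @^-1` B))%E.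
  rewrite [X in P X](_ : _ = Z @^-1` B `&` X a @^-1` A); last first.
    by apply/seteqP; split => w /= [].
  apply: avoiding_independent => //.
  have := sZ measurableT B mB; rewrite setTI; exact.
congr fine.
transitivity (\int[m']_z (psi z)%:E)%E.
  rewrite integral_distribution//.
  - by apply/measurable_EFinP; have [] := bpsi.
  - exact: (bmeasurable_integrable P (bmeasurable_comp bpsi mXZ)).
transitivity (\int[F \x Q]_z (psi z)%:E)%E.
  by apply: eq_measure_integral => C mC _; exact/esym/m'E.
rewrite -integral21_prod_meas1; last exact: (@bmeasurable_integrable _ _ _ (F \x Q)%E).
transitivity (\int[Q]_z (\int[F]_x psi (x, z))%:E)%E.
  apply: eq_integral => z _; rewrite /fubini_G EFin_mean//.
  exact: bmeasurable_comp bpsi (pair2_measurable z).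
rewrite integral_distribution//.
- by apply/measurable_EFinP; have [] := bpsiZ.
- exact: (bmeasurable_integrable P (bmeasurable_comp bpsiZ mZ)).
Qed.

Lemma mean_indep a d2 (E : measurableType d2) (Z : T -> E)
    (phi : Omega -> R) (g : E -> R) :
  measurable_fun [set: avoiding a] (Z : avoiding a -> E) ->
  bmeasurable phi -> bmeasurable g ->
  \int[P]_w (phi (X a w) * g (Z w)) = \int[F]_x phi x * \int[P]_w g (Z w).
Proof.
move=> sZ bphi bg.
have bpsi : bmeasurable (fun xz : Omega * E => phi xz.1 * g xz.2).
  apply: bmeasurableM.
    exact: bmeasurable_comp bphi measurable_fst.
  exact: bmeasurable_comp bg measurable_snd.
rewrite (freezing sZ bpsi)/= -meanZ; last first.
  exact: bmeasurable_comp bg (measurable_avoidingW sZ).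
apply: eq_Rintegral => w _; rewrite -[RHS]mulrC -meanZ//.
by apply: eq_Rintegral => x _; rewrite mulrC.
Qed.

Lemma mean_X i (phi : Omega -> R) : bmeasurable phi ->
  \int[P]_w phi (X i w) = \int[F]_x phi x.
Proof.
move=> bphi; have bpsi : bmeasurable (fun xz : Omega * unit => phi xz.1).
  exact: bmeasurable_comp bphi measurable_fst.
rewrite (@freezing i _ unit (fun=> tt) _ _ bpsi)/=; last exact: measurable_cst.
by rewrite mean_cst.
Qed.

End freezing.

(** * Stein's equation for the centred normal law *)
Section stein_equation.
Set Implicit Arguments.
Unset Strict Implicit.
Context (R : realType).
Variable s : R.
Hypothesis s_gt0 : 0 < s.

Notation mu := (@lebesgue_measure R).

Lemma normal_pdf0E x :
  normal_pdf 0 s x = normal_peak s * expR (- (x ^+ 2 / (s ^+ 2 *+ 2))).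
Proof. by rewrite normal_pdfE ?gt_eqF// /normal_fun subr0 mulNr. Qed.

Lemma normal_pdf0_gt0 x : 0 < normal_pdf 0 s x.
Proof. by rewrite normal_pdf0E mulr_gt0 ?expR_gt0// normal_peak_gt0// gt_eqF. Qed.

Lemma normal_pdf0N x : normal_pdf 0 s (- x) = normal_pdf 0 s x.
Proof. by rewrite !normal_pdf0E sqrrN. Qed.

Lemma ler_normal_pdf0 x y : `|x| <= `|y| -> normal_pdf 0 s y <= normal_pdf 0 s x.
Proof.
move=> xy; rewrite !normal_pdf0E ler_wpM2l ?normal_peak_ge0// ler_expR lerN2.
rewrite ler_wpM2r ?invr_ge0 ?mulrn_wge0 ?sqr_ge0//.
by rewrite -[leLHS]real_normK ?num_real// -[leRHS]real_normK ?num_real// lerXn2r ?nnegrE.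
Qed.

Lemma is_derive_normal_pdf0 (x : R) :
  is_derive x 1 (normal_pdf 0 s) (- (x / s ^+ 2 * normal_pdf 0 s x)).
Proof.
have -> : normal_pdf 0 s =
    fun x => normal_peak s * expR (- (x ^+ 2 / (s ^+ 2 *+ 2))).
  by apply/funext => y; rewrite normal_pdf0E.
apply: is_derive_eq.
rewrite /GRing.scale /=.
have s0 : s != 0 by rewrite gt_eqF.
field.
by rewrite s0.
Qed.

Lemma cvgy_normal_pdf0 : normal_pdf 0 s x @[x --> +oo] --> 0.
Proof.
under eq_fun do rewrite normal_pdf0E.
suff : normal_peak s * expR (- (x ^+ 2 / (s ^+ 2 *+ 2))) @[x --> +oo] -->
    normal_peak s * 0 by rewrite mulr0.
apply: cvgM; first exact: cvg_cst.
apply: (@cvg_comp _ _ _ (fun x : R => x ^+ 2 / (s ^+ 2 *+ 2)) (fun x => expR (- x)) _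
  (pinfty_nbhs R)); last exact: cvgr_expR.
apply: gt0_cvgMly; last exact: cvgr_expr2.
by rewrite invr_gt0 mulrn_wgt0// exprn_gt0.
Qed.

Lemma integrable_normal_pdf0 (A : set R) : measurable A ->
  mu.-integrable A (EFin \o normal_pdf 0 s).
Proof.
by move=> mA; apply: (integrableS measurableT) => //; exact: integrable_normal_pdf.
Qed.

(** Mills' inequality: on the tail [w <= t], and [t * q t] has the explicit
    antiderivative [- s ^+ 2 * q t], where [q] is the density. *)
Lemma normal_upper_tail (w : R) : 0 < w ->
  w * \int[mu]_(t in `[w, +oo[) normal_pdf 0 s t <= s ^+ 2 * normal_pdf 0 s w.
Proof.
move=> w0; have iq := integrable_normal_pdf0 (measurable_itv `[w, +oo[).
have cq : continuous (normal_pdf 0 s) by apply: continuous_normal_pdf; rewrite gt_eqF.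
have dq (x : R) : is_derive x 1 (fun t => - (s ^+ 2 * normal_pdf 0 s t))
    (x * normal_pdf 0 s x).
  have := is_derive_normal_pdf0 x => dqx.
  apply: is_derive_eq; rewrite /GRing.scale /=.
  have s0 : s != 0 by rewrite gt_eqF.
  by field; rewrite s0.
have ctq : continuous (fun t : R => t * normal_pdf 0 s t).
  by move=> x; apply: cvgM => //; exact: cq.
have tailE : (\int[mu]_(t in `[w, +oo[) (t * normal_pdf 0 s t)%:E =
    (s ^+ 2 * normal_pdf 0 s w)%:E)%E.
  rewrite (@ge0_continuous_FTC2y _ _ (fun t => - (s ^+ 2 * normal_pdf 0 s t)) _ 0).
  - by rewrite -EFinB sub0r opprK.
  - by move=> x wx; rewrite mulr_ge0 ?normal_pdf_ge0// (le_trans _ wx)// ltW.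
  - exact: continuous_subspaceT.
  - suff : - (s ^+ 2 * normal_pdf 0 s x) @[x --> +oo] --> - (s ^+ 2 * 0).
      by rewrite mulr0 oppr0.
    by apply: cvgN; apply: cvgM; [exact: cvg_cst|exact: cvgy_normal_pdf0].
  - by move=> x _; have [] := dq x.
  - apply: cvg_at_right_filter; apply: cvgN; apply: cvgM; first exact: cvg_cst.
    exact: cq.
  - by move=> x _; rewrite derive1E; have [_ ->] := dq x.
rewrite -RintegralZl// -lee_fin fineK; last first.
  by apply: integrable_fin_num => //; exact: (integrableZl _ w iq).
rewrite -tailE; apply: ge0_le_integral => //.
- by move=> t _; rewrite lee_fin mulr_ge0 ?normal_pdf_ge0// ltW.
- apply/measurable_funTS/measurable_EFinP/measurable_funM => //.
  exact: measurable_normal_pdf.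
- apply/measurable_funTS/measurable_EFinP; exact: continuous_measurable_fun.
- move=> t /=; rewrite in_itv/= andbT => wt.
  by rewrite lee_fin ler_wpM2r ?normal_pdf_ge0.
Qed.

Lemma normal_lower_tail (w : R) :
  \int[mu]_(t in `]-oo, (- w)]) normal_pdf 0 s t =
  \int[mu]_(t in `[w, +oo[) normal_pdf 0 s t.
Proof.
have cq : continuous (normal_pdf 0 s) by apply: continuous_normal_pdf; rewrite gt_eqF.
rewrite /Rintegral ge0_integration_by_substitutionNy.
- by congr fine; apply: eq_integral => t _; rewrite /= normal_pdf0N.
- exact: continuous_subspaceT.
- by move=> t _; exact: normal_pdf_ge0.
Qed.

Section solution.
Variable h : R -> R.
Hypotheses (ch : continuous h) (h01 : forall x, 0 <= h x <= 1).

Definition normal_mean := \int[mu]_t (h t * normal_pdf 0 s t).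
Notation c := normal_mean.

Let mq := @measurable_normal_pdf R 0 s.
Let mh : measurable_fun [set: R] h := continuous_measurable_fun ch.

Let iq (A : set R) : measurable A -> mu.-integrable A (EFin \o normal_pdf 0 s).
Proof. exact: integrable_normal_pdf0. Qed.

Let ihq (A : set R) : measurable A ->
  mu.-integrable A (EFin \o (fun t => h t * normal_pdf 0 s t)).
Proof.
move=> mA; apply: le_integrable (iq mA) => //.
  by apply/measurable_funTS/measurable_EFinP/measurable_funM.
move=> x _ /=; rewrite lee_fin normrM ler_piMl//.
by have /andP[h0 h1] := h01 x; rewrite ger0_norm.
Qed.

Lemma normal_mean01 : 0 <= c <= 1.
Proof.
apply/andP; split.
  apply: Rintegral_ge0 => x _; rewrite mulr_ge0 ?normal_pdf_ge0//.
  by have /andP[] := h01 x.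
rewrite -lee_fin fineK; last exact: integrable_fin_num (ihq measurableT).
rewrite -(integral_normal_pdf 0 s).
apply: le_integral => //; [exact: ihq|exact: iq|].
move=> x _; rewrite lee_fin ler_piMl ?normal_pdf_ge0//.
by have /andP[] := h01 x.
Qed.

Let u t := (h t - c) * normal_pdf 0 s t.

Let norm_hc t : `|h t - c| <= 1.
Proof.
have /andP[? ?] := h01 t; have /andP[? ?] := normal_mean01.
by rewrite ler_norml; apply/andP; split; lra.
Qed.

Let cu : continuous u.
Proof.
move=> x; apply: cvgM.
  by apply: cvgB; [exact: ch|exact: cvg_cst].
by apply: continuous_normal_pdf; rewrite gt_eqF.
Qed.

Let norm_u t : `|u t| <= normal_pdf 0 s t.
Proof.
by rewrite normrM (ger0_norm (normal_pdf_ge0 _ _ _)) ler_piMl// normal_pdf_ge0.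
Qed.

Let iu (A : set R) : measurable A -> mu.-integrable A (EFin \o u).
Proof.
move=> mA; apply: le_integrable (iq mA) => //.
  by apply/measurable_funTS/measurable_EFinP; exact: continuous_measurable_fun.
move=> x _ /=; rewrite lee_fin; exact: le_trans (norm_u x) (ler_norm _).
Qed.

Let int_u : \int[mu]_t u t = 0.
Proof.
rewrite /u; under eq_Rintegral do rewrite mulrBl.
rewrite RintegralB//; [|exact: ihq|exact: integrableZl (iq _)].
rewrite RintegralZl//; last exact: iq.
by rewrite -/c [X in _ - c * X](congr1 fine (integral_normal_pdf 0 s)) mulr1 subrr.
Qed.

Let G w := \int[mu]_(t in `]-oo, w]) u t.

Let dG (w : R) : is_derive w 1 G (u w).
Proof.
have [dG1 dG2] := @continuous_FTC1 R u -oo%O w (w + 1) (ltr_pwDr ltr01 (lexx w))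
  (iu (measurable_itv _)) (ltNyr _) (@cu w).
apply: DeriveDef => //.
by rewrite -derive1E.
Qed.

Let norm_G_le_lower w : `|G w| <= \int[mu]_(t in `]-oo, w]) normal_pdf 0 s t.
Proof.
rewrite (le_trans (le_normr_Rintegral _ (iu _)))//.
apply: le_Rintegral => //; [|exact: iq].
by have /integrable_abse := iu (measurable_itv `]-oo, w]).
Qed.

Let norm_G_le_upper w : `|G w| <= \int[mu]_(t in `[w, +oo[) normal_pdf 0 s t.
Proof.
have GE : G w = - \int[mu]_(t in `[w, +oo[) u t.
  rewrite -Rintegral_itv_obnd_cbnd; last exact: iu.
  rewrite -(@Rintegral_itvB R u -oo%O +oo%O w)//; last exact: iu.
  by rewrite set_itvNyy int_u sub0r opprK.
rewrite GE normrN (le_trans (le_normr_Rintegral _ (iu _)))//.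
apply: le_Rintegral => //; [|exact: iq].
by have /integrable_abse := iu (measurable_itv `[w, +oo[).
Qed.

Let norm_wG w : `|w * G w| <= s ^+ 2 * normal_pdf 0 s w.
Proof.
have [w0|w0|<-] := ltgtP 0 w.
- rewrite normrM gtr0_norm// (le_trans _ (normal_upper_tail w0))//.
  by rewrite ler_pM2l.
- rewrite normrM ltr0_norm//; have Nw0 : 0 < - w by rewrite oppr_gt0.
  rewrite -(normal_pdf0N w) (le_trans _ (normal_upper_tail Nw0))//.
  by rewrite ler_pM2l// -normal_lower_tail opprK.
- by rewrite mul0r normr0 mulr_ge0 ?sqr_ge0 ?normal_pdf_ge0.
Qed.

Let norm_G1 w : `|G w| <= 1.
Proof.
rewrite (le_trans (norm_G_le_lower w))//.
rewrite -lee_fin fineK; last exact: integrable_fin_num (iq _).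
rewrite -(integral_normal_pdf 0 s).
apply: ge0_subset_integral => //.
- by apply/measurable_EFinP.
- by move=> x _; rewrite lee_fin normal_pdf_ge0.
Qed.

(** The solution is [f w = G w / (s ^+ 2 * q w)] with [q] the normal density
    and [G] the integral of [(h - c) * q] up to [w]. As that integral over the
    whole line vanishes, [G w] is also minus the integral from [w] on; Mills'
    inequality applied to the shorter tail bounds [w * f w] by 1. That controls
    [f] outside [[-1, 1]], and inside [G] is at most 1 and [q] at least [q 1]. *)
Lemma stein_solution : exists (f : R -> R) (B : R),
  [/\ forall w : R, is_derive w 1 f ((w * f w + h w - c) / s ^+ 2),
      forall w, `|f w| <= B & forall w, `|w * f w| <= 1].
Proof.
have s0 : s != 0 by rewrite gt_eqF.
have s20 : 0 < s ^+ 2 by rewrite exprn_gt0.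
pose f w := G w * (s ^+ 2 * normal_pdf 0 s w)^-1.
have sq0 w : 0 < s ^+ 2 * normal_pdf 0 s w by rewrite mulr_gt0 ?normal_pdf0_gt0.
have wf1 w : `|w * f w| <= 1.
  rewrite /f mulrA normrM normfV [X in _ / X]gtr0_norm// ler_pdivrMr// mul1r.
  exact: norm_wG.
exists f, (1 + (s ^+ 2 * normal_pdf 0 s 1)^-1); split => // w.
  have q0 : normal_pdf 0 s w != 0 by rewrite gt_eqF// normal_pdf0_gt0.
  have dGw := dG w.
  have dq := is_derive_normal_pdf0 w.
  have dsq : is_derive w 1 (fun w => s ^+ 2 * normal_pdf 0 s w)
      (- (w * normal_pdf 0 s w)).
    by apply: is_derive_eq; rewrite /GRing.scale /=; field; rewrite s0.
  have dV := @is_deriveV R (fun w => s ^+ 2 * normal_pdf 0 s w) w _ 1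
    (lt0r_neq0 (sq0 w)) dsq.
  refine (@is_derive_eq _ _ _ f w 1 _ _ (is_deriveM dGw dV) _).
  rewrite /GRing.scale /= /f /u -/c.
  by field; rewrite s0 q0.
have [w1|w1] := leP `|w| 1; last first.
  rewrite (@le_trans _ _ 1)//; last by rewrite lerDl invr_ge0 ltW.
  by rewrite (le_trans _ (wf1 w))// [leRHS]normrM ler_peMl// ltW.
rewrite (@le_trans _ _ (s ^+ 2 * normal_pdf 0 s 1)^-1)// ?lerDr//.
rewrite /f normrM normfV [X in _ / X]gtr0_norm//.
rewrite (@le_trans _ _ (1 / (s ^+ 2 * normal_pdf 0 s w)))//.
  by rewrite ler_pM2r ?invr_gt0.
rewrite div1r lef_pV2 ?posrE// ler_pM2l// ler_normal_pdf0//.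
by rewrite normr1.
Qed.

End solution.
End stein_equation.

Section stein_regularity.
Set Implicit Arguments.
Unset Strict Implicit.
Context (R : realType).
Variable s : R.
Hypothesis s_gt0 : 0 < s.

(** The mean value theorem with an increment of either sign. *)
Lemma mean_value (f r : R -> R) (u t : R) :
  (forall w : R, is_derive w 1 f (r w)) ->
  exists2 v, `|v - u| <= `|t| & f (u + t) - f u = t * r v.
Proof.
move=> df; have cf (a b : R) : {within `[a, b], continuous f}.
  apply: derivable_within_continuous => x _.
  by have [] := df x.
have [t0|t0|<-] := ltgtP 0 t.
- have ut : u < u + t by rewrite ltrDl.
  have [v + ->] := MVT ut (fun x _ => df x) (cf _ _).
  rewrite in_itv/= => /andP[uv vt]; exists v; last by rewrite addrAC subrr add0r mulrC.
  by rewrite !gtr0_norm ?subr_gt0// lerBlDl ltW.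
- have ut : u + t < u by rewrite gtrDl.
  have [v + fE] := MVT ut (fun x _ => df x) (cf _ _).
  rewrite in_itv/= => /andP[uv vt]; exists v; last first.
    by rewrite -opprB fE -mulrN opprB addrAC subrr add0r mulrC.
  by rewrite !ltr0_norm ?subr_lt0//; lra.
- by exists u; rewrite ?subrr ?normr0// addr0 subrr mul0r.
Qed.

Variables (h : R -> R) (L : R).
Hypotheses (h01 : forall x, 0 <= h x <= 1)
  (hL : forall x y, `|h x - h y| <= L * `|x - y|).

Lemma lipschitz_continuous : continuous h.
Proof.
move=> x; apply/cvgrPdist_le => e e0; near=> y.
rewrite (le_trans (hL _ _))//.
have L1 : 0 < `|L| + 1 by rewrite ltr_wpDl.
rewrite (@le_trans _ _ ((`|L| + 1) * `|x - y|))//.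
  by rewrite ler_wpM2r// (le_trans (ler_norm _))// lerDl.
rewrite mulrC -ler_pdivlMr//; near: y.
by apply: cvgr_dist_le; [exact: cvg_id|exact: divr_gt0].
Unshelve. all: by end_near. Qed.

(** Here [r] is the derivative of the solution [f]. Writing
    [s ^+ 2 * r w = w * f w + h w - c], the increments of [r] are controlled by
    those of [f] and [h] up to the factor [1 + |u|] coming from [w * f w]; so no
    second derivative of [f] is needed for the Taylor estimate. The growth in [u]
    is harmless, because the estimate is used at a variable with bounded second
    moment. *)
Lemma stein_solution_taylor : exists (f r : R -> R) (K : R),
  [/\ bmeasurable f, bmeasurable r, 0 <= K,
      forall w, s ^+ 2 * r w - w * f w = h w - normal_mean s h &
      forall u t,
        `|r (u + t) - r u| <= K * `|t| * (1 + `|u|) /\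
        `|f (u + t) - f u - t * r u| <= K * t ^+ 2 * (1 + `|u|)].
Proof.
have ch := lipschitz_continuous.
have s20 : 0 < s ^+ 2 by rewrite exprn_gt0.
have s0 : s != 0 by rewrite gt_eqF.
have [f [B [df fB wf1]]] := stein_solution s_gt0 ch h01.
set c := normal_mean s h.
pose r w := (w * f w + h w - c) / s ^+ 2.
have /andP[c0 c1] : 0 <= c <= 1 := normal_mean01 s ch h01.
have B0 : 0 <= B by rewrite (le_trans _ (fB 0)).
have L0 : 0 <= L by have := hL 1 0; rewrite subr0 normr1 mulr1; exact: le_trans.
have cf : continuous f.
  by move=> x; apply/differentiable_continuous/derivable1_diffP; have [] := df x.
have cr : continuous r.
  move=> x; apply: cvgM; last exact: cvg_cst.
  apply: cvgB; last exact: cvg_cst.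
  by apply: cvgD; [apply: cvgM; [exact: cvg_id|exact: cf]|exact: ch].
pose B' := 2 / s ^+ 2.
have B'0 : 0 <= B' by rewrite divr_ge0// ltW.
have rB w : `|r w| <= B'.
  rewrite normrM normfV [X in _ / X]gtr0_norm// ler_pM2r ?invr_gt0//.
  rewrite -addrA (le_trans (ler_normD _ _))// -[leRHS]/(1 + 1) lerD//.
  by have /andP[? ?] := h01 w; rewrite ler_norml; apply/andP; split; lra.
pose K := (B + B' + L) / s ^+ 2.
have K0 : 0 <= K by rewrite divr_ge0 ?addr_ge0// ltW.
have fL u t : `|f (u + t) - f u| <= B' * `|t|.
  have [v _ ->] := @mean_value f r u t df.
  by rewrite normrM mulrC ler_wpM2r.
have rL u t : `|r (u + t) - r u| <= K * `|t| * (1 + `|u|).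
  have -> : r (u + t) - r u =
      (t * f (u + t) + u * (f (u + t) - f u) + (h (u + t) - h u)) / s ^+ 2.
    by rewrite /r; field; rewrite s0.
  rewrite normrM normfV [X in _ / X]gtr0_norm//.
  rewrite /K mulrAC -mulrA [leRHS]mulrAC ler_pM2r ?invr_gt0//.
  have h1 : `|t * f (u + t)| <= `|t| * B by rewrite normrM ler_wpM2l.
  have h2 : `|u * (f (u + t) - f u)| <= `|u| * (B' * `|t|) by rewrite normrM ler_wpM2l.
  have h3 : `|h (u + t) - h u| <= L * `|t|.
    by rewrite (le_trans (hL _ _))// addrAC subrr add0r.
  rewrite (le_trans (ler_normD _ _))// (le_trans (lerD (ler_normD _ _) (lexx _)))//.
  rewrite (le_trans (lerD (lerD h1 h2) h3))//.
  have := mulr_ge0 B0 (mulr_ge0 (normr_ge0 t) (normr_ge0 u)).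
  have := mulr_ge0 L0 (mulr_ge0 (normr_ge0 t) (normr_ge0 u)).
  have := mulr_ge0 B'0 (normr_ge0 t).
  by set a := `|t|; set b := `|u|; nra.
exists f, r, K; split => //.
- by split; [exact: continuous_measurable_fun|exists B].
- by split; [exact: continuous_measurable_fun|exists B'].
- by move=> w; rewrite /r; field; rewrite s0.
- move=> u t; split => //.
  have [v vt ->] := @mean_value f r u t df.
  rewrite -mulrBr normrM.
  have -> : r v - r u = r (u + (v - u)) - r u by rewrite [u + (v - u)]addrC subrK.
  rewrite (le_trans (ler_wpM2l (normr_ge0 t) (rL u (v - u))))//.
  rewrite mulrA ler_wpM2r ?addr_ge0//.
  rewrite -[t ^+ 2]real_normK ?num_real// expr2 mulrCA ler_wpM2l//.
  by rewrite ler_wpM2l.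
Qed.

End stein_regularity.

(** * Stein's method for a normalized sum of bounded variables *)
Section stein_sum.
Set Implicit Arguments.
Unset Strict Implicit.
Context (R : realType) d d' (T : measurableType d) (Omega : measurableType d').
Context (P : probability T R) (F : probability Omega R).
Variable X : nat -> {RV P >-> Omega}.
Hypothesis X_iid : iid F X.
Variables (psi : Omega -> R) (B s : R).
Hypotheses (mpsi : measurable_fun [set: Omega] psi)
  (psiB : forall x, `|psi x| <= B).
Hypotheses (psi_mean : \int[F]_x psi x = 0)
  (psi_var : \int[F]_x psi x ^+ 2 = s ^+ 2).

Let bpsi : bmeasurable psi. Proof. by split => //; exists B. Qed.

Let B_ge0 : 0 <= B.
Proof.
have := mean_le F (bmeasurable_norm bpsi) (bmeasurable_cst _ B) psiB.
by rewrite mean_cst; apply: le_trans; exact: Rintegral_ge0.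
Qed.

Let bpsiX i : bmeasurable (fun w => psi (X i w)).
Proof. exact: bmeasurable_comp. Qed.

(** In what follows [scaled_sum n] is the normalized sum
    [n ^ (-1/2) * (psi (X 0) + .. + psi (X (n - 1)))]. *)
Definition scaled n i w := psi (X i w) / Num.sqrt n%:R.
Definition scaled_sum n w := \sum_(i < n) scaled n i w.
Definition scaled_sum_but n (i : 'I_n) w := \sum_(j < n | j != i) scaled n j w.

Lemma scaled_sumE n (i : 'I_n) w :
  scaled_sum n w = scaled_sum_but i w + scaled n i w.
Proof. by rewrite /scaled_sum (bigD1 i)//= addrC. Qed.

Lemma bmeasurable_scaled n i : bmeasurable (scaled n i).
Proof.
by apply: bmeasurableM => //; exact: bmeasurable_cst.
Qed.

Lemma bmeasurable_scaled_sum n : bmeasurable (scaled_sum n).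
Proof. by apply: bmeasurable_sum => i _; exact: bmeasurable_scaled. Qed.

Lemma bmeasurable_scaled_sum_but n (i : 'I_n) : bmeasurable (scaled_sum_but i).
Proof. by apply: bmeasurable_sum => j _; exact: bmeasurable_scaled. Qed.

Lemma scaled_sum_but_avoiding n (i : 'I_n) :
  measurable_fun [set: avoiding X i] (scaled_sum_but i : avoiding X i -> R).
Proof.
rewrite /scaled_sum_but; under eq_fun do rewrite -big_filter.
have := seq.filter_all (fun j => j != i) (index_enum 'I_n).
elim: (seq.filter _ _) => [_|j r ih] /=.
  by under eq_fun do rewrite big_nil; exact: measurable_cst.
move=> /andP[ji /ih mr]; under eq_fun do rewrite big_cons.
apply: measurable_funD => //; apply: measurable_funM => //.
apply: (measurableT_comp mpsi); exact: measurable_avoiding_X.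
Qed.

Let bpsiM k : bmeasurable (fun x => psi x ^+ k).
Proof. exact: bmeasurableX. Qed.

Lemma mean_scaled_orth n (i j : 'I_n) : i != j ->
  \int[P]_w (scaled n i w * scaled n j w) = 0.
Proof.
move=> ij.
transitivity (\int[P]_w (n%:R^-1 * (psi (X i w) * psi (X j w)))).
  apply: eq_Rintegral => w _; rewrite /scaled mulrACA -invfM -expr2.
  by rewrite sqr_sqrtr ?ler0n// mulrC.
rewrite meanZ; last exact: bmeasurableM.
rewrite (mean_indep X_iid (a := i) (Z := X j) (phi := psi) (g := psi))//.
  by rewrite psi_mean mul0r mulr0.
by apply: measurable_avoiding_X; rewrite eq_sym; apply: contraNN ij => /eqP/ord_inj ->.
Qed.

Lemma mean_scaled_indep n (i : 'I_n) (g : R -> R) : bmeasurable g ->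
  \int[P]_w (scaled n i w * g (scaled_sum_but i w)) = 0.
Proof.
move=> bg.
transitivity (\int[P]_w ((Num.sqrt n%:R)^-1 *
    (psi (X i w) * g (scaled_sum_but i w)))).
  by apply: eq_Rintegral => w _; rewrite /scaled mulrAC mulrC.
have mSi := @scaled_sum_but_avoiding n i.
rewrite meanZ; last first.
  apply: bmeasurableM => //; apply: bmeasurable_comp bg _.
  exact: measurable_avoidingW mSi.
by rewrite (mean_indep X_iid mSi)// psi_mean mul0r mulr0.
Qed.

Lemma mean_scaled_sqr_indep n (i : 'I_n) (g : R -> R) : bmeasurable g ->
  \int[P]_w (scaled n i w ^+ 2 * g (scaled_sum_but i w)) =
  s ^+ 2 / n%:R * \int[P]_w g (scaled_sum_but i w).
Proof.
move=> bg.
transitivity (\int[P]_w (n%:R^-1 *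
    (psi (X i w) ^+ 2 * g (scaled_sum_but i w)))).
  apply: eq_Rintegral => w _; rewrite /scaled expr_div_n sqr_sqrtr ?ler0n//.
  by rewrite mulrAC mulrC.
have mSi := @scaled_sum_but_avoiding n i.
rewrite meanZ; last first.
  apply: bmeasurableM => //; first exact: (bmeasurable_comp (bpsiM 2)).
  apply: bmeasurable_comp bg _; exact: measurable_avoidingW mSi.
rewrite (mean_indep X_iid mSi (phi := fun x => psi x ^+ 2))// psi_var.
by rewrite mulrCA mulrA.
Qed.

Lemma mean_scaled_sqr n (i : 'I_n) :
  \int[P]_w (scaled n i w ^+ 2) = s ^+ 2 / n%:R.
Proof.
have := mean_scaled_sqr_indep i (bmeasurable_cst _ 1).
by under eq_Rintegral do rewrite mulr1; rewrite mean_cst mulr1.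
Qed.

Lemma mean_scaled_sum_sqr n : (0 < n)%N ->
  \int[P]_w (scaled_sum n w ^+ 2) = s ^+ 2.
Proof.
move=> n0.
transitivity (\int[P]_w \sum_(i < n) \sum_(j < n) scaled n i w * scaled n j w).
  apply: eq_Rintegral => w _; rewrite expr2 /scaled_sum mulr_suml.
  by apply: eq_bigr => i _; rewrite mulr_sumr.
have bM (i j : 'I_n) : bmeasurable (fun w => scaled n i w * scaled n j w).
  by apply: bmeasurableM; exact: bmeasurable_scaled.
rewrite mean_sum; last by move=> i _; apply: bmeasurable_sum.
transitivity (\sum_(i < n) s ^+ 2 / n%:R).
  apply: eq_bigr => i _; rewrite mean_sum; last by move=> j _.
  rewrite (bigD1 i)//= big1 ?addr0; last first.
    by move=> j ji; rewrite mean_scaled_orth// eq_sym.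
  by under eq_Rintegral do rewrite -expr2; rewrite mean_scaled_sqr.
by rewrite sumr_const card_ord -[LHS]mulr_natr divfK// pnatr_eq0 -lt0n.
Qed.

Lemma scaled_bound n i w : `|scaled n i w| <= B / Num.sqrt n%:R.
Proof.
rewrite normrM normfV (ger0_norm (sqrtr_ge0 _)).
by rewrite ler_wpM2r ?invr_ge0 ?sqrtr_ge0.
Qed.

Section stein_bound.
Variables (f r : R -> R) (K : R).
Hypotheses (bf : bmeasurable f) (br : bmeasurable r) (K0 : 0 <= K).
Hypothesis taylor : forall u t,
  `|r (u + t) - r u| <= K * `|t| * (1 + `|u|) /\
  `|f (u + t) - f u - t * r u| <= K * t ^+ 2 * (1 + `|u|).

Let mV n : measurable_fun [set: T] (scaled_sum n).
Proof. by have [] := bmeasurable_scaled_sum n. Qed.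

(** Expand [f (W)] around [W - xi], where [xi] is the [i]-th summand: since [xi]
    is independent of [W - xi], has mean 0 and second moment [s ^+ 2 / n], the
    terms of order 0 and 1 contribute exactly the mean of
    [s ^+ 2 / n * r (W - xi)]. What remains is of third order in
    [1 / sqrt n], as [|xi| <= B / sqrt n]. *)
Lemma stein_sum_term n (i : 'I_n) :
  `|\int[P]_w (s ^+ 2 / n%:R * r (scaled_sum n w) - scaled n i w * f (scaled_sum n w))|
  <= K * (s ^+ 2 + B ^+ 2) * B * (2 + s ^+ 2 + B) / (n%:R * Num.sqrt n%:R).
Proof.
have n0 : (0 < n)%N by case: n i => // -[].
have n0R : 0 < n%:R :> R by rewrite ltr0n.
set q := Num.sqrt n%:R; have q1 : 1 <= q.
  by rewrite -sqrtr1 ler_sqrt ?ler1n.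
have q0 : 0 < q by rewrite (lt_le_trans _ q1).
have qE : q ^+ 2 = n%:R by rewrite sqr_sqrtr// ltW.
have bxi := bmeasurable_scaled n i.
have bSi := bmeasurable_scaled_sum_but i.
have bS := bmeasurable_scaled_sum n.
have mSi : measurable_fun [set: T] (scaled_sum_but i) by case: bSi.
have bfS : bmeasurable (fun w => f (scaled_sum n w)) by exact: bmeasurable_comp.
have brS : bmeasurable (fun w => r (scaled_sum n w)) by exact: bmeasurable_comp.
have bfSi : bmeasurable (fun w => f (scaled_sum_but i w)) by exact: bmeasurable_comp.
have brSi : bmeasurable (fun w => r (scaled_sum_but i w)) by exact: bmeasurable_comp.
(* [D] differs from the integrand by terms whose means cancel by independence *)
pose D w := s ^+ 2 / n%:R * (r (scaled_sum n w) - r (scaled_sum_but i w)) -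
  scaled n i w * (f (scaled_sum n w) - f (scaled_sum_but i w) -
                  scaled n i w * r (scaled_sum_but i w)).
have bD : bmeasurable D.
  apply: bmeasurableB; first by apply: bmeasurableZ; exact: bmeasurableB.
  apply: bmeasurableM => //; apply: bmeasurableB; first exact: bmeasurableB.
  exact: bmeasurableM.
have -> : \int[P]_w (s ^+ 2 / n%:R * r (scaled_sum n w) -
    scaled n i w * f (scaled_sum n w)) = \int[P]_w D w.
  transitivity (\int[P]_w (D w + (s ^+ 2 / n%:R * r (scaled_sum_but i w) -
      scaled n i w ^+ 2 * r (scaled_sum_but i w)
       - scaled n i w * f (scaled_sum_but i w)))).
    by apply: eq_Rintegral => w _; rewrite /D; ring.
  have b1 : bmeasurable (fun w => s ^+ 2 / n%:R * r (scaled_sum_but i w)).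
    exact: bmeasurableZ.
  have b2 : bmeasurable (fun w => scaled n i w ^+ 2 * r (scaled_sum_but i w)).
    by apply: bmeasurableM => //; exact: bmeasurableX.
  have b3 : bmeasurable (fun w => scaled n i w * f (scaled_sum_but i w)).
    exact: bmeasurableM.
  have b12 := bmeasurableB b1 b2.
  rewrite (meanD _ bD (bmeasurableB b12 b3)) (meanB _ b12 b3).
  rewrite meanB// meanZ// mean_scaled_sqr_indep// mean_scaled_indep//.
  by rewrite subrr subrr addr0.
pose C := K * (s ^+ 2 + B ^+ 2) * B / (n%:R * q).
have C0 : 0 <= C.
  by rewrite /C divr_ge0 ?mulr_ge0 ?addr_ge0 ?sqr_ge0 ?ler0n ?sqrtr_ge0.
have bound w : `|D w| <= C * (2 + B + scaled_sum n w ^+ 2).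
  set x := scaled n i w; set S := scaled_sum n w; set Si := scaled_sum_but i w.
  have SE : S = Si + x by exact: scaled_sumE.
  have xB : `|x| <= B / q := scaled_bound n i w.
  have [] := taylor Si x; rewrite -SE => t1 t2.
  have Bq0 : 0 <= B / q by rewrite divr_ge0// ltW.
  have Si2 : 1 + `|Si| <= 2 + B + S ^+ 2.
    have -> : Si = S - x by rewrite SE addrK.
    rewrite (le_trans (lerD (lexx _) (ler_normB _ _)))//.
    have xB' : `|x| <= B by rewrite (le_trans xB)// ler_pdivrMr// ler_peMr.
    have S2 : `|S| <= 1 + S ^+ 2.
      rewrite -[S ^+ 2]real_normK ?num_real//.
      by have := normr_ge0 S; set a := `|S|; nra.
    lra.
  have x2 : x ^+ 2 <= B ^+ 2 / n%:R.
    rewrite -qE -expr_div_n -[x ^+ 2]real_normK ?num_real//.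
    by rewrite lerXn2r ?nnegrE.
  rewrite (@le_trans _ _ (C * (1 + `|Si|)))//; last by rewrite ler_wpM2l.
  rewrite /D -/x -/S -/Si.
  have sn0 : 0 <= s ^+ 2 / n%:R by rewrite divr_ge0 ?sqr_ge0 ?ler0n.
  rewrite (le_trans (ler_normB _ _))// (normrM (s ^+ 2 / _)) (normrM x).
  rewrite (ger0_norm sn0).
  have e1 : s ^+ 2 / n%:R * `|r S - r Si| <=
      s ^+ 2 / n%:R * (K * (B / q) * (1 + `|Si|)).
    rewrite ler_wpM2l// (le_trans t1)//.
    by rewrite ler_wpM2r ?addr_ge0// ler_wpM2l.
  have e2 : `|x| * `|f S - f Si - x * r Si| <=
      B / q * (K * (B ^+ 2 / n%:R) * (1 + `|Si|)).
    apply: ler_pM => //; rewrite (le_trans t2)//.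
    by rewrite ler_wpM2r ?addr_ge0// ler_wpM2l.
  rewrite (le_trans (lerD e1 e2))// le_eqVlt; apply/orP; left; apply/eqP.
  rewrite /C; field.
  by rewrite !gt_eqF.
rewrite (le_trans (norm_mean_le _ bD))//.
have bS2 : bmeasurable (fun w => scaled_sum n w ^+ 2) by exact: bmeasurableX.
have bc : bmeasurable (fun w : T => 2 + B) by exact: bmeasurable_cst.
rewrite (le_trans (mean_le P (bmeasurable_norm bD) _ bound))//.
  by apply: bmeasurableZ; exact: bmeasurableD.
rewrite meanZ; last exact: bmeasurableD.
rewrite meanD// mean_cst mean_scaled_sum_sqr//.
by rewrite /C le_eqVlt; apply/orP; left; apply/eqP; field; rewrite !gt_eqF.
Qed.

(** Summing the [n] terms leaves the rate [1 / sqrt n]. *)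
Lemma stein_sum_bound n : (0 < n)%N ->
  `|\int[P]_w (s ^+ 2 * r (scaled_sum n w) - scaled_sum n w * f (scaled_sum n w))|
  <= K * (s ^+ 2 + B ^+ 2) * B * (2 + s ^+ 2 + B) / Num.sqrt n%:R.
Proof.
move=> n0; have n0R : 0 < n%:R :> R by rewrite ltr0n.
have q0 : 0 < Num.sqrt n%:R :> R by rewrite sqrtr_gt0.
have bS := bmeasurable_scaled_sum n.
have bfS : bmeasurable (fun w => f (scaled_sum n w)) by exact: bmeasurable_comp.
have brS : bmeasurable (fun w => r (scaled_sum n w)) by exact: bmeasurable_comp.
rewrite (_ : \int[P]_w _ = \sum_(i < n) \int[P]_w (s ^+ 2 / n%:R * r (scaled_sum n w)
   - scaled n i w * f (scaled_sum n w))); last first.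
  rewrite -mean_sum; last first.
    move=> i _; apply: bmeasurableB; first exact: bmeasurableZ.
    by apply: bmeasurableM => //; exact: bmeasurable_scaled.
  apply: eq_Rintegral => w _.
  rewrite big_split /= sumr_const card_ord sumrN -mulr_suml -/(scaled_sum n w).
  by congr (_ - _); rewrite -[RHS]mulr_natr; field; rewrite gt_eqF.
rewrite (le_trans (ler_norm_sum _ _ _))//.
rewrite (le_trans (ler_sum _ (fun i _ => stein_sum_term i)))//.
rewrite sumr_const card_ord -[leLHS]mulr_natr le_eqVlt; apply/orP; left; apply/eqP.
by field; rewrite !gt_eqF.
Qed.

End stein_bound.
End stein_sum.

(** * From Lipschitz test functions to distribution functions *)
Section lipschitz_test_functions.
Set Implicit Arguments.
Unset Strict Implicit.
Context (R : realType).
Notation mu := (@lebesgue_measure R).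

(** Projection of the real line on [[0, 1]]. *)
Definition clamp01 (x : R) := Num.min 1 (Num.max 0 x).

Lemma clamp01_itv x : 0 <= clamp01 x <= 1.
Proof. by rewrite /clamp01 ge_min lexx/= le_min ler01/= le_max lexx. Qed.

Lemma clamp01_lipschitz x y : `|clamp01 x - clamp01 y| <= `|x - y|.
Proof.
wlog xy : x y / y <= x.
  move=> H; have [/ltW|] := ltP x y; last exact: H.
  by move=> /H; rewrite distrC [leRHS]distrC.
rewrite (ger0_norm (x := x - y)) ?subr_ge0//.
rewrite ler_norml /clamp01 !minElt !maxElt.
by repeat case: ifPn; rewrite -?leNgt => *; apply/andP; split; lra.
Qed.

(** A Lipschitz function lying between the indicators of the half-lines ending
    at [a] and at [b]. *)
Definition ramp (a b t : R) := clamp01 ((b - t) / (b - a)).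

Lemma ramp_itv a b t : 0 <= ramp a b t <= 1.
Proof. exact: clamp01_itv. Qed.

Lemma ramp_lipschitz a b : a < b ->
  forall x y, `|ramp a b x - ramp a b y| <= (b - a)^-1 * `|x - y|.
Proof.
move=> ab x y; have ba : 0 < b - a by rewrite subr_gt0.
rewrite (le_trans (clamp01_lipschitz _ _))//.
rewrite -mulrBl normrM normfV (gtr0_norm ba) mulrC ler_wpM2l ?invr_ge0 ?(ltW ba)//.
have -> : b - x - (b - y) = - (x - y) by ring.
by rewrite normrN.
Qed.

Lemma ramp_below a b t : a < b -> t <= a -> ramp a b t = 1.
Proof.
move=> ab ta; have ba : 0 < b - a by rewrite subr_gt0.
have : 1 <= (b - t) / (b - a) by rewrite ler_pdivlMr// mul1r lerD2l lerN2.
rewrite /ramp /clamp01 => h1; rewrite max_r; first by rewrite min_l.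
by rewrite (le_trans ler01).
Qed.

Lemma ramp_above a b t : a < b -> b <= t -> ramp a b t = 0.
Proof.
move=> ab bt; have ba : 0 < b - a by rewrite subr_gt0.
have : (b - t) / (b - a) <= 0 by rewrite pmulr_lle0 ?invr_gt0// subr_le0.
by rewrite /ramp /clamp01 => h0; rewrite max_l// min_r.
Qed.

Section convergence.
Context d (T : measurableType d) (P : probability T R).
Variables (A : nat -> T -> R) (s : R).
Hypothesis mA : forall n, measurable_fun [set: T] (A n).

Let cdfA n x := fine (P (A n @^-1` `]-oo, x])).
Let Phi x := fine (normal_prob 0 s `]-oo, x]).

Let mAx n x : measurable (A n @^-1` `]-oo, x]).
Proof. by rewrite -[_ @^-1` _]setTI; apply: mA. Qed.

Let cdfAE n x : cdfA n x = \int[P]_w \1_(A n @^-1` `]-oo, x]) w.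
Proof. by rewrite /Rintegral integral_indic// setIT. Qed.

Let b1 n x : bmeasurable (\1_(A n @^-1` `]-oo, x]) : T -> R).
Proof.
split; first exact: measurable_indic.
by exists 1 => w; rewrite indicE; case: (_ \in _); rewrite ?normr1 ?normr0.
Qed.

Let bramp a b n : a < b -> bmeasurable (fun w => ramp a b (A n w)).
Proof.
move=> ab; have cr := lipschitz_continuous (ramp_lipschitz ab).
split; first by apply: measurableT_comp => //; exact: continuous_measurable_fun.
by exists 1 => w; have /andP[? ?] := ramp_itv a b (A n w); rewrite ger0_norm.
Qed.

Let cdfA_le_ramp a b n : a < b -> cdfA n a <= \int[P]_w ramp a b (A n w).
Proof.
move=> ab; rewrite cdfAE; apply: mean_le => //; first exact: bramp.
move=> w; rewrite indicE; case: (boolP (_ \in _)) => [|_].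
  by rewrite inE /= in_itv/= => wa; rewrite ramp_below.
by have /andP[] := ramp_itv a b (A n w).
Qed.

Let ramp_le_cdfA a b n : a < b -> \int[P]_w ramp a b (A n w) <= cdfA n b.
Proof.
move=> ab; rewrite cdfAE; apply: mean_le => //; first exact: bramp.
move=> w; rewrite indicE; case: (boolP (_ \in _)) => [_|].
  by have /andP[] := ramp_itv a b (A n w).
rewrite notin_setE /= in_itv/= => /negP; rewrite -ltNge => /ltW bw.
by rewrite ramp_above.
Qed.

Let PhiE x : Phi x = \int[mu]_t (normal_pdf 0 s \_ `]-oo, x]) t.
Proof. by rewrite /Phi /normal_prob -Rintegral_mkcond. Qed.

Let iPhi x : mu.-integrable [set: R] (EFin \o (normal_pdf 0 s \_ `]-oo, x])).
Proof.
rewrite -restrict_EFin; apply/integrable_restrict => //.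
by rewrite setTI; exact: integrable_normal_pdf0.
Qed.

Let iramp a b : a < b ->
  mu.-integrable [set: R] (EFin \o (fun t => ramp a b t * normal_pdf 0 s t)).
Proof.
move=> ab; have cr := lipschitz_continuous (ramp_lipschitz ab).
apply: le_integrable (integrable_normal_pdf0 s measurableT) => //.
  apply/measurable_EFinP/measurable_funM; last exact: measurable_normal_pdf.
  exact: continuous_measurable_fun.
move=> x _ /=; rewrite lee_fin normrM ler_piMl//.
by have /andP[h0 h1] := ramp_itv a b x; rewrite ger0_norm.
Qed.

Let Phi_le_ramp a b : a < b -> Phi a <= normal_mean s (ramp a b).
Proof.
move=> ab; rewrite PhiE; apply: le_Rintegral => //; first exact: iramp.
move=> t _; rewrite patchE; case: (boolP (_ \in _)) => [|_].
  by rewrite inE /= in_itv/= => wa; rewrite ramp_below// mul1r.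
by have /andP[? _] := ramp_itv a b t; rewrite mulr_ge0// normal_pdf_ge0.
Qed.

Let ramp_le_Phi a b : a < b -> normal_mean s (ramp a b) <= Phi b.
Proof.
move=> ab; rewrite PhiE; apply: le_Rintegral => //; first exact: iramp.
move=> t _; rewrite patchE; case: (boolP (_ \in _)) => [_|].
  by have /andP[_ ?] := ramp_itv a b t; rewrite ler_piMl// normal_pdf_ge0.
rewrite notin_setE /= in_itv/= => /negP; rewrite -ltNge => /ltW bw.
by rewrite ramp_above// mul0r.
Qed.

(** Ramps over [[x, x + dd]] and [[x - dd, x]] squeeze the distribution function
    at [x] between means of Lipschitz functions whose limits lie between the
    limiting distribution function at [x - dd] and at [x + dd]. *)
Lemma cvg_cdf_of_lipschitz :
  (forall (h : R -> R) L, (forall x, 0 <= h x <= 1) ->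
     (forall x y, `|h x - h y| <= L * `|x - y|) ->
     \int[P]_w h (A n w) @[n --> \oo] --> normal_mean s h) ->
  forall x : R,
    {for x, continuous (fun t : R => normal_prob 0 s `]-oo, t]%classic)} ->
    P (A n @^-1` `]-oo, x]%classic) @[n --> \oo] --> normal_prob 0 s `]-oo, x]%classic.
Proof.
move=> hA x cx.
have PhiEF y : (Phi y)%:E = normal_prob 0 s `]-oo, y].
  by rewrite /Phi fineK//; exact: fin_num_measure.
have cdfEF n : (cdfA n x)%:E = P (A n @^-1` `]-oo, x]).
  by rewrite /cdfA fineK//; exact: fin_num_measure.
rewrite -PhiEF; under eq_fun do rewrite -cdfEF.
apply: cvg_EFin; first by near=> n.
change (cdfA n x @[n --> \oo] --> Phi x).
have cPhi : Phi t @[t --> x] --> Phi x.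
  by apply: fine_cvg; rewrite PhiEF.
apply/cvgrPdist_lt => e e0.
have e20 : 0 < e / 2 by rewrite divr_gt0.
move: cPhi => /cvgrPdist_lt/(_ _ e20)[dl /= dl0 Hd].
pose dd := dl / 2.
have dd0 : 0 < dd by rewrite divr_gt0.
have ddl : dd < dl by rewrite /dd ltr_pdivrMr// ltr_pMr// ltr1n.
have xr : x < x + dd by rewrite ltrDl.
have xl : x - dd < x by rewrite ltrBlDr ltrDl.
have Hr : `|Phi x - Phi (x + dd)| < e / 2.
  by apply: Hd; rewrite /ball_ /= opprD addrA subrr sub0r normrN gtr0_norm.
have Hl : `|Phi x - Phi (x - dd)| < e / 2.
  by apply: Hd; rewrite /ball_ /= opprB addrC subrK gtr0_norm.
have Ar := hA _ _ (@ramp_itv x (x + dd)) (ramp_lipschitz xr).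
have Al := hA _ _ (@ramp_itv (x - dd) x) (ramp_lipschitz xl).
move: Ar => /cvgrPdist_lt/(_ _ e20) Ar.
move: Al => /cvgrPdist_lt/(_ _ e20) Al.
near=> n.
have Nr : `|normal_mean s (ramp x (x + dd)) - \int[P]_w ramp x (x + dd) (A n w)| < e / 2.
  by near: n; exact: Ar.
have Nl : `|normal_mean s (ramp (x - dd) x) - \int[P]_w ramp (x - dd) x (A n w)| < e / 2.
  by near: n; exact: Al.
have := cdfA_le_ramp n xr; have := ramp_le_cdfA n xl.
have := Phi_le_ramp xl; have := ramp_le_Phi xr.
move: Nr Nl Hr Hl; rewrite !ltr_norml => /andP[? ?] /andP[? ?] /andP[? ?] /andP[? ?].
by move=> *; apply/andP; split; lra.
Unshelve. all: by end_near. Qed.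

End convergence.
End lipschitz_test_functions.

(** * Second moment of a degenerate U-statistic *)
Section degenerate_kernel.
Set Implicit Arguments.
Unset Strict Implicit.
Context (R : realType) d d' (T : measurableType d) (Omega : measurableType d').
Context (P : probability T R) (F : probability Omega R).
Variable X : nat -> {RV P >-> Omega}.
Hypothesis X_iid : iid F X.
Variables (g : Omega -> Omega -> R) (C : R).
Hypotheses (mg : measurable_fun [set: Omega * Omega] (fun z => g z.1 z.2))
  (gC : forall x y, `|g x y| <= C) (g_sym : forall x y, g x y = g y x)
  (g_degenerate : forall y, \int[F]_x g x y = 0).

Let bg : bmeasurable (fun z : Omega * Omega => g z.1 z.2).
Proof. by split => //; exists C => -[x y]; exact: gC. Qed.

Let bgX i j : bmeasurable (fun w => g (X i w) (X j w)).
Proof.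
apply: (bmeasurable_comp (h := fun w => (X i w, X j w)) bg).
exact: measurable_fun_pair.
Qed.

(** Integrating out [X i], which occurs in the first factor only, gives 0 by
    degeneracy. *)
Lemma mean_degenerate_mul i j k l : i != j -> i != k -> i != l ->
  \int[P]_w (g (X i w) (X j w) * g (X k w) (X l w)) = 0.
Proof.
move=> ij ik il.
pose psi (z : Omega * (Omega * (Omega * Omega))) :=
  g z.1 z.2.1 * g z.2.2.1 z.2.2.2.
have bpsi : bmeasurable psi.
  apply: bmeasurableM.
    apply: (bmeasurable_comp (h := fun z => (z.1, z.2.1)) bg).
    apply: measurable_fun_pair; first exact: measurable_fst.
    exact: measurableT_comp measurable_fst measurable_snd.
  apply: (bmeasurable_comp (h := fun z => (z.2.2.1, z.2.2.2)) bg).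
  have m22 : measurable_fun [set: Omega * (Omega * (Omega * Omega))] (fun z => z.2.2).
    exact: measurableT_comp measurable_snd measurable_snd.
  apply: measurable_fun_pair; last exact: measurableT_comp measurable_snd m22.
  exact: measurableT_comp measurable_fst m22.
have sZ : measurable_fun [set: avoiding X i]
    ((fun w => (X j w, (X k w, X l w))) : avoiding X i -> Omega * (Omega * Omega)).
  apply: measurable_fun_pair; first by apply: measurable_avoiding_X; rewrite eq_sym.
  by apply: measurable_fun_pair; apply: measurable_avoiding_X; rewrite eq_sym.
rewrite (freezing X_iid sZ bpsi) -[RHS](mean_cst P 0).
apply: eq_Rintegral => w _; rewrite /psi /=.
transitivity (\int[F]_x (g (X k w) (X l w) * g x (X j w))).
  by apply: eq_Rintegral => x _; rewrite mulrC.
rewrite meanZ ?g_degenerate ?mulr0//.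
exact: (bmeasurable_comp bg (pair2_measurable (X j w))).
Qed.

Definition off_diagonal_sum n w :=
  \sum_(i < n) \sum_(j < n | j != i) g (X i w) (X j w).

Lemma off_diagonal_sumE n w : off_diagonal_sum n w =
  \sum_(p : 'I_n * 'I_n | p.2 != p.1) g (X p.1 w) (X p.2 w).
Proof. by rewrite /off_diagonal_sum pair_big_dep. Qed.

Lemma bmeasurable_off_diagonal_sum n : bmeasurable (off_diagonal_sum n).
Proof. by apply: bmeasurable_sum => i _; apply: bmeasurable_sum => j _. Qed.

(** Expand the square over two ordered pairs. If the pairs do not have the same
    two indices, one index of the first pair is missing from the second and the
    term vanishes; so each first pair leaves at most two terms. *)
Lemma mean_off_diagonal_sum_sqr n :
  \int[P]_w (off_diagonal_sum n w ^+ 2) <= 2 * C ^+ 2 * n%:R ^+ 2.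
Proof.
pose gp (p : 'I_n * 'I_n) w := g (X p.1 w) (X p.2 w).
have bgp p q : bmeasurable (fun w => gp p w * gp q w)
  by exact: bmeasurableM (bgX _ _) (bgX _ _).
have C20 : 0 <= C ^+ 2 := sqr_ge0 C.
have term (p q : 'I_n * 'I_n) : p.2 != p.1 -> q.2 != q.1 ->
    \int[P]_w (gp p w * gp q w) <=
    C ^+ 2 * ((q == p)%:R + (q == (p.2, p.1))%:R).
  case: p q => [i j] [k l] /= ji lk.
  have [/orP|] := boolP (((k, l) == (i, j)) || ((k, l) == (j, i))).
    move=> E; rewrite (@le_trans _ _ (C ^+ 2))//.
      rewrite (le_trans (ler_norm _))// norm_mean_bound// => w.
      by rewrite normrM expr2 ler_pM// gC.
    rewrite -[leLHS]mulr1 ler_wpM2l//.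
    have := ler0n R ((k, l) == (i, j)); have := ler0n R ((k, l) == (j, i)).
    by case: E => -> /=; lra.
  rewrite negb_or => /andP[n1 n2].
  rewrite (negbTE n1) (negbTE n2) addr0 mulr0 le_eqVlt; apply/orP; left; apply/eqP.
  have ij : i != j by rewrite eq_sym.
  have [ikl|] := boolP ((i == k) || (i == l)); last first.
    by rewrite negb_or => /andP[ik il]; exact: mean_degenerate_mul.
  have [jkl|] := boolP ((j == k) || (j == l)); last first.
    rewrite negb_or => /andP[jk jl].
    transitivity (\int[P]_w (g (X j w) (X i w) * g (X k w) (X l w))).
      by apply: eq_Rintegral => w _; rewrite /gp /= g_sym.
    exact: mean_degenerate_mul.
  move: n1 n2; rewrite !xpair_eqE.
  by case/orP: ikl jkl ji => /eqP -> /orP[] /eqP ->; rewrite ?eqxx//= ?andbT.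
rewrite (_ : \int[P]_w _ =
    \sum_(p | p.2 != p.1) \sum_(q | q.2 != q.1) \int[P]_w (gp p w * gp q w)); last first.
  transitivity (\int[P]_w \sum_(p | p.2 != p.1) \sum_(q | q.2 != q.1) gp p w * gp q w).
    apply: eq_Rintegral => w _; rewrite off_diagonal_sumE expr2 mulr_suml.
    by apply: eq_bigr => p _; rewrite mulr_sumr.
  rewrite mean_sum; last by move=> p _; exact: bmeasurable_sum.
  by apply: eq_bigr => p _; rewrite mean_sum.
have sum1 (p : 'I_n * 'I_n) : \sum_q (q == p)%:R = 1 :> R.
  by rewrite (bigD1 p)//= eqxx big1 ?addr0// => q /negbTE ->.
apply: (@le_trans _ _ (\sum_(p : 'I_n * 'I_n) 2 * C ^+ 2)).
  rewrite big_mkcond; apply: ler_sum => p _; case: ifP => [pp|_]; last first.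
    by rewrite mulr_ge0.
  apply: (@le_trans _ _ (\sum_q C ^+ 2 * ((q == p)%:R + (q == (p.2, p.1))%:R))).
    rewrite big_mkcond; apply: ler_sum => q _; case: ifP => [qq|_]; first exact: term.
    by rewrite mulr_ge0// addr_ge0.
  by rewrite -mulr_sumr big_split/= !sum1 mulrC.
by rewrite sumr_const card_prod card_ord -[leLHS]mulr_natr natrM expr2.
Qed.

End degenerate_kernel.

(** * Counting the edges of the underlying graph *)
Section underlying_graph_edges.
Set Implicit Arguments.
Unset Strict Implicit.

(** An edge is an unordered pair, and [i < j] selects one ordered pair from
    each. *)
Lemma card_underlying_edges n (A : {set 'I_n * 'I_n}) :
  #|underlying_edges A| =
  (\sum_(i < n) \sum_(j < n | i < j) (((i, j) \in A) || ((j, i) \in A)))%N.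
Proof.
pose adj (p : 'I_n * 'I_n) := (p \in A) || ((p.2, p.1) \in A).
pose S := [set p : 'I_n * 'I_n | (p.1 < p.2)%N && adj p]%SET.
pose e (p : 'I_n * 'I_n) := [set p.1; p.2]%SET.
have -> : underlying_edges A = (e @: S)%SET.
  apply/setP => D; rewrite inE; apply/idP/imsetP.
    move=> /existsP[i /existsP[j /and3P[ij /eqP -> a]]].
    have [ltij|ltji|/ord_inj eij] := ltngtP i j.
    - by exists (i, j) => //; rewrite inE /= ltij.
    - by exists (j, i); [rewrite inE /= ltji /adj/= orbC|rewrite /e /= finset.setUC].
    - by rewrite eij eqxx in ij.
  move=> [[i j] + ->]; rewrite inE /adj /= => /andP[ltij a].
  apply/existsP; exists i; apply/existsP; exists j.
  by rewrite eqxx a !andbT; apply: contraTneq ltij => ->; rewrite ltnn.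
rewrite card_in_imset; last first.
  move=> [i j] [k l]; rewrite !inE /= /e /= => /andP[ij _] /andP[kl _] E.
  have : i \in [set k; l]%SET by rewrite -E set21.
  have : j \in [set k; l]%SET by rewrite -E set22.
  rewrite !inE => /orP[] /eqP jE /orP[] /eqP iE; subst i j => //.
  - by rewrite ltnn in ij.
  - by have := ltn_trans ij kl; rewrite ltnn.
  - by rewrite ltnn in ij.
rewrite -sum1_card pair_big_dep /= [RHS](bigID adj)/= [X in _ = (_ + X)%N]big1 ?addn0.
  apply: eq_big => [p|p]; first by rewrite inE.
  by rewrite inE => /andP[_]; case: p => i j; rewrite /adj /= => ->.
by move=> [i j] /andP[_]; rewrite /adj /= => /negbTE ->.
Qed.

Lemma sum_off_diagonal (V : zmodType) n (k : 'I_n -> 'I_n -> V) :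
  (forall i j, k i j = k j i) ->
  \sum_(i < n) \sum_(j < n | j != i) k i j =
  (\sum_(i < n) \sum_(j < n | (i < j)%N) k i j) *+ 2.
Proof.
move=> k_sym; rewrite mulr2n.
rewrite [X in _ = _ + X](exchange_big_dep xpredT)//= -big_split /=.
apply: eq_bigr => i _; rewrite (bigID (fun j : 'I_n => (i < j)%N))/=; congr (_ + _).
  by apply: eq_bigl => j; rewrite -val_eqE /=; lia.
by apply: eq_big => [j|j _]; [rewrite -val_eqE /=; lia|rewrite k_sym].
Qed.

End underlying_graph_edges.

(** * Central limit theorem up to a remainder small in mean square *)
Section stein_clt.
Set Implicit Arguments.
Unset Strict Implicit.
Context (R : realType) d d' (T : measurableType d) (Omega : measurableType d').
Context (P : probability T R) (F : probability Omega R).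
Variable X : nat -> {RV P >-> Omega}.
Hypothesis X_iid : iid F X.
Variables (psi : Omega -> R) (B s : R).
Hypotheses (s_gt0 : 0 < s) (mpsi : measurable_fun [set: Omega] psi)
  (psiB : forall x, `|psi x| <= B).
Hypotheses (psi_mean : \int[F]_x psi x = 0)
  (psi_var : \int[F]_x psi x ^+ 2 = s ^+ 2).
Variables (A : nat -> T -> R) (C : R).
Let W n := scaled_sum X psi n.
Let D n w := A n w - W n w.
Hypotheses (mA : forall n, measurable_fun [set: T] (A n))
  (bD : forall n, (2 <= n)%N -> bmeasurable (D n))
  (D_sqr : forall n, (2 <= n)%N -> \int[P]_w (D n w ^+ 2) <= C / n%:R).

(** Replacing [A n] by the sum [W n] costs at most [L * E|D n|], which the
    second moment bounds by a multiple of [1 / sqrt n]; Stein's equation handles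
    [W n] at the same rate. *)
Lemma stein_clt_rate (h : R -> R) (L : R) : (forall x, 0 <= h x <= 1) ->
  (forall x y, `|h x - h y| <= L * `|x - y|) ->
  exists K, forall n, (2 <= n)%N ->
    `|\int[P]_w h (A n w) - normal_mean s h| <= K / Num.sqrt n%:R.
Proof.
move=> h01 hL.
have L0 : 0 <= L by have := hL 1 0; rewrite subr0 normr1 mulr1; exact: le_trans.
have mh := continuous_measurable_fun (lipschitz_continuous hL).
have bh (Y : T -> R) : measurable_fun [set: T] Y -> bmeasurable (fun w => h (Y w)).
  move=> mY; split; first exact: measurableT_comp.
  by exists 1 => w; have /andP[? ?] := h01 (Y w); rewrite ger0_norm.
have [f [r [K [bf br K0 stein taylor]]]] := stein_solution_taylor s_gt0 h01 hL.
exists (L * (1 + C) + K * (s ^+ 2 + B ^+ 2) * B * (2 + s ^+ 2 + B)) => n n2.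
have n0 : (0 < n)%N by rewrite (ltn_trans _ n2).
set q := Num.sqrt n%:R.
have q0 : 0 < q by rewrite sqrtr_gt0 ltr0n.
have qE : q ^+ 2 = n%:R by rewrite sqr_sqrtr.
have bW : bmeasurable (W n) := bmeasurable_scaled_sum X mpsi psiB n.
have [mW _] := bW.
have bhA := bh _ (mA n); have bhW := bh _ mW.
have -> : \int[P]_w h (A n w) - normal_mean s h =
    \int[P]_w (h (A n w) - h (W n w)) +
    \int[P]_w (s ^+ 2 * r (W n w) - W n w * f (W n w)).
  under [X in _ = _ + X]eq_Rintegral do rewrite stein.
  rewrite meanB// meanB//; last exact: bmeasurable_cst.
  by rewrite mean_cst addrA subrK.
rewrite (le_trans (ler_normD _ _))// mulrDl lerD//; last first.
  exact (stein_sum_bound X_iid mpsi psiB psi_mean psi_var bf br K0 taylor n0).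
have bdiff := bmeasurableB bhA bhW.
have bD2 : bmeasurable (fun w => D n w ^+ 2) by apply: bmeasurableX; exact: bD.
have bc : bmeasurable (fun w : T => q^-1) by exact: bmeasurable_cst.
have bb : bmeasurable (fun w => L * (q^-1 + q * D n w ^+ 2)).
  by apply: bmeasurableZ; apply: bmeasurableD => //; exact: bmeasurableZ.
rewrite (le_trans (norm_mean_le P bdiff))//.
rewrite (@le_trans _ _ (\int[P]_w (L * (q^-1 + q * D n w ^+ 2))))//.
  apply: mean_le => //; first exact: bmeasurable_norm.
  move=> w; rewrite (le_trans (hL _ _))// -/(D n w) ler_wpM2l//.
  (* the two terms are balanced by the expected size [1/q] of [|D|]: the first
     one dominates when [|D| <= 1/q], the second one otherwise *)
  rewrite -[D n w ^+ 2]real_normK ?num_real//; set a := `|D n w|.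
  have a0 : 0 <= a by exact: normr_ge0.
  have [aq|qa] := leP a q^-1; first by rewrite (le_trans aq)// lerDl mulr_ge0 ?exprn_ge0 ?(ltW q0).
  rewrite (@le_trans _ _ (q * a ^+ 2))// ?lerDr ?invr_ge0 ?(ltW q0)//.
  by rewrite expr2 mulrA ler_peMl// -(divff (lt0r_neq0 q0)) ler_pM2l// ltW.
rewrite meanZ; last by apply: bmeasurableD => //; exact: bmeasurableZ.
rewrite meanD//; last exact: bmeasurableZ.
rewrite mean_cst meanZ// -mulrA ler_wpM2l//.
rewrite mulrDl mul1r lerD2l.
have -> : C / q = q * (C / n%:R) by rewrite -qE; field; rewrite gt_eqF.
by rewrite ler_wpM2l ?D_sqr ?(ltW q0).
Qed.

Lemma stein_clt_cdf (x : R) :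
  {for x, continuous (fun t : R => normal_prob 0 s `]-oo, t]%classic)} ->
  P (A n @^-1` `]-oo, x]%classic) @[n --> \oo] --> normal_prob 0 s `]-oo, x]%classic.
Proof.
apply: cvg_cdf_of_lipschitz => // h L h01 hL.
have [K HK] := stein_clt_rate h01 hL.
apply/cvgrPdist_le => e e0; near=> n.
rewrite distrC (le_trans (HK n _))//; first by near: n; exact: nbhs_infty_ge.
have n0 : (0 < n)%N by near: n; exact: nbhs_infty_gt.
rewrite ler_pdivrMr ?sqrtr_gt0 ?ltr0n// mulrC -ler_pdivrMr//.
rewrite (le_trans (ler_norm _))// -sqrtr_sqr ler_sqrt ?ler0n//.
by near: n; exact: nbhs_infty_ger.
Unshelve. all: by end_near. Qed.

End stein_clt.

(** * The edge kernel of a proximity map *)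
Section pcd_kernel.
Set Implicit Arguments.
Unset Strict Implicit.
Context (R : realType) d d' (T : measurableType d) (Omega : measurableType d').
Context (P : probability T R) (F : probability Omega R).
Variables (X : nat -> {RV P >-> Omega}) (N : Omega -> set Omega).
Hypotheses (X_iid : iid F X) (mN : measurable_proximity N).

Definition edge_kernel (x y : Omega) : R := \1_(N x `|` Gamma1 N x) y.
Notation k := edge_kernel.

Lemma edge_kernelE x y : k x y = (`[< N x y >] || `[< N y x >])%:R.
Proof.
rewrite /k indicE; congr (nat_of_bool _)%:R.
by apply/idP/orP; rewrite inE => -[] /asboolP; auto => ?; [left|right].
Qed.

Lemma edge_kernel_sym x y : k x y = k y x.
Proof. by rewrite !edge_kernelE orbC. Qed.

Lemma edge_kernel01 x y : 0 <= k x y <= 1.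
Proof. by rewrite edge_kernelE; case: (_ || _); rewrite /= ?lexx ler01. Qed.

Lemma measurable_edge_kernel :
  measurable_fun [set: Omega * Omega] (fun z => k z.1 z.2).
Proof.
pose E := [set z : Omega * Omega | N z.1 z.2].
pose sw (z : Omega * Omega) := (z.2, z.1).
have msw : measurable_fun [set: Omega * Omega] sw.
  by apply: measurable_fun_pair; [exact: measurable_snd|exact: measurable_fst].
have mE : measurable (E `|` sw @^-1` E).
  by apply: measurableU => //; rewrite -[_ @^-1` _]setTI; exact: msw.
rewrite (_ : (fun z => _) = \1_(E `|` sw @^-1` E)); first exact: measurable_indic.
by apply/funext => -[x y]; rewrite /k !indicE.
Qed.

Lemma bmeasurable_edge_kernel : bmeasurable (fun z : Omega * Omega => k z.1 z.2).
Proof.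
split; first exact: measurable_edge_kernel.
by exists 1 => z; have /andP[? ?] := edge_kernel01 z.1 z.2; rewrite ger0_norm.
Qed.

Let bk := bmeasurable_edge_kernel.

Let bkl y : bmeasurable (fun x => k x y).
Proof. exact: (bmeasurable_comp bk (pair2_measurable y)). Qed.

Let bkX i j : bmeasurable (fun w => k (X i w) (X j w)).
Proof.
apply: (bmeasurable_comp (h := fun w => (X i w, X j w)) bk).
exact: measurable_fun_pair.
Qed.

(** The probability that a given point is joined to a random one. *)
Definition edge_degree (y : Omega) : R := \int[F]_x k x y.
Definition edge_mean : R := \int[F]_y edge_degree y.
(** The first-order term of the Hoeffding decomposition of the kernel. *)
Definition edge_projection (y : Omega) : R := edge_degree y - edge_mean.
(** The second-order term of the Hoeffding decomposition: integrating out either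
    argument gives 0. *)
Definition edge_residual (x y : Omega) : R :=
  k x y - edge_mean - edge_projection x - edge_projection y.

Let bdeg : bmeasurable edge_degree.
Proof. exact: (bmeasurable_freeze F bk). Qed.

Let bproj : bmeasurable edge_projection.
Proof. by apply: bmeasurableB => //; exact: bmeasurable_cst. Qed.

Let mean01 d0 (U : measurableType d0) (Q : probability U R) (f : U -> R) :
  bmeasurable f -> (forall x, 0 <= f x <= 1) -> 0 <= \int[Q]_x f x <= 1.
Proof.
move=> bf f01; apply/andP; split.
  by apply: Rintegral_ge0 => x _; have /andP[] := f01 x.
rewrite -[leRHS](mean_cst Q); apply: mean_le => //; first exact: bmeasurable_cst.
by move=> x; have /andP[] := f01 x.
Qed.

Let deg01 y : 0 <= edge_degree y <= 1.
Proof. by apply: mean01 => // x; exact: edge_kernel01. Qed.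

Let emean01 : 0 <= edge_mean <= 1.
Proof. exact: mean01. Qed.

Lemma edge_projection_mean : \int[F]_y edge_projection y = 0.
Proof.
rewrite meanB//; last exact: bmeasurable_cst.
by rewrite mean_cst subrr.
Qed.

Lemma edge_residual_degenerate y : \int[F]_x edge_residual x y = 0.
Proof.
rewrite /edge_residual.
have bc (c : R) : bmeasurable (fun _ : Omega => c) by exact: bmeasurable_cst.
have b1 := bmeasurableB (bkl y) (bc edge_mean).
rewrite (meanB F (bmeasurableB b1 bproj) (bc _)) (meanB F b1 bproj).
by rewrite (meanB F (bkl y) (bc _)) !mean_cst edge_projection_mean subr0 subrr.
Qed.

Lemma edge_residual_sym x y : edge_residual x y = edge_residual y x.
Proof. by rewrite /edge_residual edge_kernel_sym addrAC. Qed.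

Lemma edge_residual_bound x y : `|edge_residual x y| <= 2.
Proof.
rewrite /edge_residual /edge_projection.
have /andP[? ?] := edge_kernel01 x y; have /andP[? ?] := emean01.
have /andP[? ?] := deg01 x; have /andP[? ?] := deg01 y.
by rewrite ler_norml; apply/andP; split; lra.
Qed.

Lemma measurable_edge_residual :
  measurable_fun [set: Omega * Omega] (fun z => edge_residual z.1 z.2).
Proof.
have [mp _] := bproj.
apply: measurable_funB; last exact: measurableT_comp mp measurable_snd.
apply: measurable_funB; last exact: measurableT_comp mp measurable_fst.
by apply: measurable_funB => //; exact: measurable_edge_kernel.
Qed.

Lemma mean_edge_kernel i j : i != j ->
  \int[P]_w k (X i w) (X j w) = edge_mean.
Proof.
move=> ij; have sZ := @measurable_avoiding_X _ _ _ _ _ _ X i j.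
rewrite (freezing X_iid (a := i) (Z := X j) (psi := fun z => k z.1 z.2))//.
  exact: (mean_X X_iid j bdeg).
by apply: sZ; rewrite eq_sym.
Qed.

Lemma p_orE i j : i != j -> p_or X N i j = edge_mean.
Proof.
move=> ij; rewrite -(mean_edge_kernel ij) /p_or /Rintegral; congr fine.
set S := [set w | _].
have SE : (fun w => k (X i w) (X j w)) = \1_S.
  by apply/funext => w; rewrite /k !indicE.
have mS : measurable S.
  by have [+ _] := bkX i j; rewrite SE => /measurable_indicP.
by rewrite -[in LHS](setIT S) -integral_indic.
Qed.

(** Integrating out [X j], then [X l], turns both factors of the covariance into
    the projection at their common vertex [X i]. *)
Lemma nu_orE i j l : i != j -> i != l -> j != l ->
  nu_or X N i j l = \int[F]_y edge_projection y ^+ 2.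
Proof.
move=> ij il jl.
have hE a b w : h_or X N a b w = k (X a w) (X b w) by [].
have EE a b : a != b -> fine 'E_P[h_or X N a b] = edge_mean.
  by move=> ab; rewrite unlock -(mean_edge_kernel ab).
rewrite /nu_or covariance.unlock !EE// unlock.
transitivity (\int[P]_w ((k (X j w) (X i w) - edge_mean) *
    (k (X i w) (X l w) - edge_mean))).
  by congr fine; apply: eq_integral => w _; rewrite edge_kernel_sym.
have bc0 d0 (U : measurableType d0) : bmeasurable (fun _ : U => edge_mean).
  exact: bmeasurable_cst.
have bker y := bmeasurableB (bkl y) (bc0 _ Omega).
pose psi1 (z : Omega * (Omega * Omega)) :=
  (k z.1 z.2.1 - edge_mean) * (k z.2.1 z.2.2 - edge_mean).
have bpsi1 : bmeasurable psi1.
  apply: bmeasurableM; apply: bmeasurableB => //.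
    apply: (bmeasurable_comp (h := fun z : Omega * (Omega * Omega) => (z.1, z.2.1)) bk).
    apply: measurable_fun_pair; first exact: measurable_fst.
    exact: measurableT_comp measurable_fst measurable_snd.
  apply: (bmeasurable_comp (h := fun z : Omega * (Omega * Omega) => z.2) bk).
  exact: measurable_snd.
have sZ1 : measurable_fun [set: avoiding X j]
    ((fun w => (X i w, X l w)) : avoiding X j -> Omega * Omega).
  by apply: measurable_fun_pair; apply: measurable_avoiding_X; rewrite // eq_sym.
rewrite (freezing X_iid sZ1 bpsi1).
transitivity (\int[P]_w (edge_projection (X i w) * (k (X l w) (X i w) - edge_mean))).
  apply: eq_Rintegral => w _; rewrite /psi1 /= mulrC edge_kernel_sym -[RHS]mulrC.
  transitivity (\int[F]_x ((k (X l w) (X i w) - edge_mean) * (k x (X i w) - edge_mean))).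
    by apply: eq_Rintegral => x _; rewrite mulrC edge_kernel_sym.
  by rewrite (meanZ F _ (bker (X i w))) (meanB F (bkl _) (bc0 _ _)) mean_cst mulrC.
pose psi2 (z : Omega * Omega) := (k z.1 z.2 - edge_mean) * edge_projection z.2.
have bpsi2 : bmeasurable psi2.
  apply: bmeasurableM; first exact: bmeasurableB.
  exact: (bmeasurable_comp bproj measurable_snd).
have sZ2 : measurable_fun [set: avoiding X l] (X i : avoiding X l -> Omega).
  exact: measurable_avoiding_X.
transitivity (\int[P]_w psi2 (X l w, X i w)).
  by apply: eq_Rintegral => w _; rewrite /psi2 mulrC.
rewrite (freezing X_iid sZ2 bpsi2) -(mean_X X_iid i (bmeasurableX 2 bproj)).
apply: eq_Rintegral => w _; rewrite /psi2 /=.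
transitivity (\int[F]_x (edge_projection (X i w) * (k x (X i w) - edge_mean))).
  by apply: eq_Rintegral => x _; rewrite mulrC.
by rewrite (meanZ F _ (bker (X i w))) (meanB F (bkl _) (bc0 _ _)) mean_cst -expr2.
Qed.

Definition edge_sum n w : R :=
  \sum_(i < n) \sum_(j < n | (i < j)%N) k (X i w) (X j w).

Lemma rho_orE n w :
  rho_or X N n w = 2 * edge_sum n w / (n%:R * (n%:R - 1)).
Proof.
rewrite /rho_or /relative_edge_density card_underlying_edges natr_sum.
congr (2 * _ / _); apply: eq_bigr => i _; rewrite natr_sum.
apply: eq_bigr => j ij; rewrite edge_kernelE /pcd_arcs !inE /=.
by rewrite -!val_eqE /= neq_ltn ij eq_sym neq_ltn ij.
Qed.

Lemma edge_sum_off_diagonal n w : 2 * edge_sum n w =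
  \sum_(i < n) \sum_(j < n | j != i) k (X i w) (X j w).
Proof.
rewrite sum_off_diagonal; first by rewrite mulr_natl.
by move=> i j; exact: edge_kernel_sym.
Qed.

Lemma sum_off_diagonal_cst n (c : R) :
  \sum_(i < n) \sum_(j < n | j != i) c = n%:R * (n%:R - 1) * c.
Proof.
under eq_bigr do rewrite sumr_const cardC1 card_ord.
rewrite sumr_const card_ord -[LHS]mulr_natr -[X in X * _]mulr_natr.
by case: n => [|n]; rewrite ?mulr0 ?mul0r// -natr1 addrK /=; ring.
Qed.

Lemma bmeasurable_rho_or n : bmeasurable (rho_or X N n).
Proof.
rewrite (_ : rho_or X N n = fun w => 2 * edge_sum n w / (n%:R * (n%:R - 1))).
  apply: bmeasurableM; last exact: bmeasurable_cst.
  by apply: bmeasurableZ; apply: bmeasurable_sum => i _; apply: bmeasurable_sum => j _.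
by apply/funext => w; exact: rho_orE.
Qed.

Lemma sample_size_gt0 n : (2 <= n)%N -> (0 < n%:R * (n%:R - 1) :> R).
Proof.
move=> n2; rewrite mulr_gt0 ?ltr0n ?(ltn_trans _ n2)//.
by rewrite subr_gt0 ltr1n.
Qed.

(** The normalization [n (n - 1) / 2] is the number of pairs. *)
Lemma rho_or_U_statistic n w : (2 <= n)%N ->
  rho_or X N n w = ('C(n, 2)%:R)^-1 * edge_sum n w.
Proof.
move=> n2; rewrite rho_orE.
have C2 : n%:R * (n%:R - 1) = 2 * 'C(n, 2)%:R :> R.
  rewrite -natrM -mul_bin_diag bin1 natrM.
  by case: n n2 => // n _; rewrite -natr1 addrK.
have C0 : 'C(n, 2)%:R != 0 :> R by rewrite pnatr_eq0 -lt0n bin_gt0.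
by rewrite C2; field.
Qed.

Lemma mean_rho_or n : (2 <= n)%N -> \int[P]_w rho_or X N n w = edge_mean.
Proof.
move=> n2; have D0 := sample_size_gt0 n2.
transitivity (\int[P]_w ((n%:R * (n%:R - 1))^-1 *
    \sum_(i < n) \sum_(j < n | j != i) k (X i w) (X j w))).
  by apply: eq_Rintegral => w _; rewrite rho_orE edge_sum_off_diagonal mulrC.
rewrite meanZ; last first.
  by apply: bmeasurable_sum => i _; apply: bmeasurable_sum => j _.
rewrite mean_sum; last by move=> i _; apply: bmeasurable_sum => j _.
rewrite (eq_bigr (fun i : 'I_n => \sum_(j < n | j != i) edge_mean)); last first.
  move=> i _; rewrite mean_sum; last by move=> j _.
  by apply: eq_bigr => j ji; rewrite mean_edge_kernel// eq_sym.
by rewrite sum_off_diagonal_cst mulrA mulVf ?mul1r// gt_eqF.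
Qed.

(** Each projection occurs [2 (n - 1)] times in the sum over ordered pairs,
    which turns the normalization [1 / (n (n - 1))] into [2 / n]. *)
Lemma hoeffding_decomposition n w : (2 <= n)%N ->
  Num.sqrt n%:R * (rho_or X N n w - edge_mean) =
  scaled_sum X (fun x => 2 * edge_projection x) n w +
  Num.sqrt n%:R / (n%:R * (n%:R - 1)) * off_diagonal_sum X edge_residual n w.
Proof.
move=> n2; have D0 := sample_size_gt0 n2.
have n0 : 0 < n%:R :> R by rewrite ltr0n (ltn_trans _ n2).
have n1 : 0 < n%:R - 1 :> R by rewrite subr_gt0 ltr1n.
set q := Num.sqrt n%:R.
have q0 : 0 < q by rewrite sqrtr_gt0.
have qE : n%:R = q ^+ 2 by rewrite sqr_sqrtr// ltW.
pose Sp := \sum_(i < n) edge_projection (X i w).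
have sumk : 2 * edge_sum n w = off_diagonal_sum X edge_residual n w +
    (n%:R - 1) * Sp *+ 2 + n%:R * (n%:R - 1) * edge_mean.
  have inner (i : 'I_n) : \sum_(j < n | j != i) edge_projection (X i w) =
      (n%:R - 1) * edge_projection (X i w).
    rewrite sumr_const cardC1 card_ord -[LHS]mulr_natl; congr (_ * _).
    by case: n {n2 D0 n0 n1 q q0 qE Sp} i => [[]//|n _]; rewrite -natr1 addrK.
  have left : \sum_(i < n) \sum_(j < n | j != i) edge_projection (X i w) =
      (n%:R - 1) * Sp by under eq_bigr do rewrite inner; rewrite -mulr_sumr.
  have right : \sum_(i < n) \sum_(j < n | j != i) edge_projection (X j w) =
      (n%:R - 1) * Sp.
    rewrite -left [LHS](exchange_big_dep xpredT)//=.
    by apply: eq_bigr => i _; apply: eq_bigl => j; rewrite eq_sym.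
  rewrite edge_sum_off_diagonal -sum_off_diagonal_cst mulr2n -{1}left -right.
  rewrite -!big_split/=; apply: eq_bigr => i _.
  rewrite -!big_split/=; apply: eq_bigr => j _.
  by rewrite /edge_residual; ring.
have -> : scaled_sum X (fun x => 2 * edge_projection x) n w = 2 * Sp / q.
  by rewrite /scaled_sum /scaled -mulr_suml -mulr_sumr.
rewrite rho_orE sumk.
have : q ^+ 2 - 1 != 0 by rewrite -qE gt_eqF.
rewrite qE => h; field.
by rewrite h gt_eqF.
Qed.

Section clt.
Variable s : R.
Hypotheses (s_gt0 : 0 < s)
  (s_var : 4 * \int[F]_y edge_projection y ^+ 2 = s ^+ 2).

(** The main term of the decomposition is a normalized sum of variables bounded
    by 2 with variance [s ^+ 2], and its remainder has second moment at most
    [8 n / (n - 1) ^ 2 <= 32 / n]. *)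
Lemma rho_or_clt (x : R) :
  {for x, continuous (fun t : R => normal_prob 0 s `]-oo, t]%classic)} ->
  P ((fun w => Num.sqrt n%:R * (rho_or X N n w - edge_mean)) @^-1`
      `]-oo, x]%classic) @[n --> \oo] --> normal_prob 0 s `]-oo, x]%classic.
Proof.
have [mproj _] := bproj.
have bV n := bmeasurable_off_diagonal_sum X measurable_edge_residual
  edge_residual_bound n.
have DE n : (2 <= n)%N ->
    (fun w => Num.sqrt n%:R * (rho_or X N n w - edge_mean) -
              scaled_sum X (fun x => 2 * edge_projection x) n w) =
    (fun w => Num.sqrt n%:R / (n%:R * (n%:R - 1)) *
              off_diagonal_sum X edge_residual n w).
  move=> n2; apply/funext => w; rewrite hoeffding_decomposition//.
  by rewrite addrAC subrr add0r.
apply: (@stein_clt_cdf _ _ _ _ _ P F X X_iid (fun x => 2 * edge_projection x) 2 s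
  s_gt0 _ _ _ _ (fun n w => Num.sqrt n%:R * (rho_or X N n w - edge_mean)) 32).
- exact: measurable_funM.
- move=> y; rewrite normrM ger0_norm// -[leRHS]mulr1 ler_wpM2l//.
  have /andP[? ?] := deg01 y; have /andP[? ?] := emean01.
  by rewrite /edge_projection ler_norml; apply/andP; split; lra.
- by rewrite meanZ// edge_projection_mean mulr0.
- transitivity (\int[F]_y (4 * edge_projection y ^+ 2)).
    by apply: eq_Rintegral => y _; ring.
  by rewrite meanZ//; exact: bmeasurableX.
- move=> n; apply: measurable_funM => //; apply: measurable_funB => //.
  by case: (bmeasurable_rho_or n).
- by move=> n n2; rewrite DE//; exact: bmeasurableZ.
- move=> n n2.
  have n0 : 0 < n%:R :> R by rewrite ltr0n (ltn_trans _ n2).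
  have n1 : 0 < n%:R - 1 :> R by rewrite subr_gt0 ltr1n.
  have m2 : 2 <= n%:R :> R by rewrite ler_nat.
  rewrite (_ : \int[P]_w _ = \int[P]_w (n%:R / (n%:R * (n%:R - 1)) ^+ 2 *
      off_diagonal_sum X edge_residual n w ^+ 2)); last first.
    apply: eq_Rintegral => w _.
    by rewrite (congr1 (@^~ w) (DE _ n2)) exprMn expr_div_n sqr_sqrtr// ltW.
  rewrite meanZ; last exact: bmeasurableX.
  rewrite (@le_trans _ _ (n%:R / (n%:R * (n%:R - 1)) ^+ 2 * (2 * 2 ^+ 2 * n%:R ^+ 2)))//.
    rewrite ler_wpM2l ?divr_ge0 ?sqr_ge0 ?(ltW n0)//.
    exact: (mean_off_diagonal_sum_sqr X_iid measurable_edge_residual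
      edge_residual_bound edge_residual_sym edge_residual_degenerate).
  have -> : n%:R / (n%:R * (n%:R - 1)) ^+ 2 * (2 * 2 ^+ 2 * n%:R ^+ 2) =
      8 * n%:R / (n%:R - 1) ^+ 2 :> R.
    by field; rewrite !gt_eqF.
  rewrite ler_pdivrMr ?exprn_gt0// mulrAC ler_pdivlMr//.
  by move: m2; set m := n%:R; nra.
Qed.

End clt.
End pcd_kernel.

Theorem corollary3p3 (R : realType) (d d' : measure_display)
    (T : measurableType d) (Omega : measurableType d')
    (P : probability T R) (F : probability Omega R)
    (X : nat -> {RV P >-> Omega}) (N : Omega -> set Omega)
    (X_iid : iid F X) (mN : measurable_proximity N) :
  [/\ is_U_statistic_deg2 F X (rho_or X N),
      (forall i j : nat, i != j -> forall n : nat, (2 <= n)%N ->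
        'E_P[rho_or X N n] = (p_or X N i j)%:E)%E &
      ((forall i j k : nat, i != j -> i != k -> j != k ->
          0 < nu_or X N i j k) ->
       forall i j k : nat, i != j -> i != k -> j != k ->
        cvg_in_law P
          (fun n w => Num.sqrt n%:R * (rho_or X N n w - p_or X N i j))
          (normal_law 0 (4 * nu_or X N i j k)))].
Proof.
split.
- exists (edge_kernel R N); split.
  + exact: measurable_edge_kernel.
  + exact: edge_kernel_sym.
  + exact: (bmeasurable_integrable (F \x F)%E (bmeasurable_edge_kernel R mN)).
  + by move=> n n2 w; rewrite rho_or_U_statistic.
- move=> i j ij n n2; rewrite unlock -EFin_mean; last exact: bmeasurable_rho_or.
  by rewrite (mean_rho_or X_iid mN n2) (p_orE X_iid mN ij).
- move=> nu_gt0 i j k ij ik jk; split.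
    move=> n; apply: measurable_funM => //; apply: measurable_funB => //.
    by have [] := bmeasurable_rho_or X mN n.
  have nu0 := nu_gt0 _ _ _ ij ik jk.
  rewrite (p_orE X_iid mN ij) /normal_law => x cx.
  apply: (rho_or_clt X_iid mN) cx; first by rewrite sqrtr_gt0 mulr_gt0.
  by rewrite sqr_sqrtr ?mulr_ge0 ?(ltW nu0)// (nu_orE X_iid mN ij ik jk).
Qed.
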